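(* There exists an absolute constant $c>0$ such that for every integer $d\ge7$, every $G>0$, every integer $T\ge1$ and every real number $\mathcal P_{T,1}$ with $0\le\mathcal P_{T,1}\le\frac{T}{8d}-1$, $$\mathfrak R_T^\Delta(\mathcal P_{T,1})\ \ge\ c\,G\sqrt{\frac{dT(1+\mathcal P_{T,1})}{\log d}},$$ where $$\mathfrak R_T^\Delta(\mathcal P_{T,1})=\inf_{\mathcal A}\ \sup_{f_1,\dots,f_T\in\mathcal F_\Delta(G)}\ \mathbb E\Big[\sum_{t=1}^T\frac{f_t(x^{t,+})+f_t(x^{t,-})}{2}-\inf_{(u^1,\dots,u^T)\in\mathcal C_T^\Delta(\mathcal P_{T,1})}\sum_{t=1}^Tf_t(u^t)\Big].$$
   Context: $\Delta_d=\{x\in\mathbb R^d:x\ge0,\ \sum_jx_j=1\}$; $\log$ is the natural logarithm. $\mathcal F_\Delta(G)$ is the class of convex functions $f:\Delta_d\to\mathbb R$ with $|f(x)-f(y)|\le G\|x-y\|_1$ for all $x,y\in\Delta_d$. $\mathcal C_T^\Delta(P)=\{(u^1,\dots,u^T)\in\Delta_d^T:\sum_{t=1}^{T-1}\|u^{t+1}-u^t\|_1\le P\}$. The infimum is over all (possibly randomized) two-point bandit algorithms $\mathcal A$ on the simplex: at each round $t$ the algorithm chooses two points $x^{t,+},x^{t,-}\in\Delta_d$ as a (measurable) function of its internal randomness and of the previously observed values $f_s(x^{s,+}),f_s(x^{s,-})$, $s<t$, and then observes $f_t(x^{t,+})$ and $f_t(x^{t,-})$. The expectation is over the algorithm's randomness.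 *)

(* Defs.v *)
From HB Require Import structures.
From mathcomp Require Import all_boot all_order all_algebra.
From mathcomp Require Import all_classical all_reals all_analysis.
Import Order.TTheory GRing.Theory Num.Theory.
Import numFieldNormedType.Exports.

Set Implicit Arguments.
Unset Strict Implicit.
Unset Printing Implicit Defensive.

Local Open Scope classical_set_scope.
Local Open Scope ring_scope.

Definition norm1 (R : realType) (d : nat) (x : 'rV[R]_d) : R :=
  \sum_(j < d) `|x 0 j|.

Definition simplex (R : realType) (d : nat) : set 'rV[R]_d :=
  [set x | (forall j, 0 <= x 0 j) /\ \sum_(j < d) x 0 j = 1].

(* Functions on the simplex are total functions on 'rV[R]_d; only their values
   on the simplex are constrained, and only those values are ever used. *)
Definition convex_lipschitz (R : realType) (d : nat) (G : R) :
    set ('rV[R]_d -> R) :=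
  [set f | convex_function (@simplex R d) f /\
    forall x y, simplex x -> simplex y -> `|f x - f y| <= G * norm1 (x - y)].

(* Rounds are numbered 0, ..., T - 1, in the loss sequences, the comparator
   sequences and the queries alike; the values of a nat-indexed sequence at
   t >= T are irrelevant. *)
Definition loss_sequences (R : realType) (d : nat) (G : R) (T : nat) :
    set (nat -> 'rV[R]_d -> R) :=
  [set f | forall t, (t < T)%N -> convex_lipschitz G (f t)].

Definition comparators (R : realType) (d T : nat) (P : R) :
    set (nat -> 'rV[R]_d) :=
  [set u | (forall t, (t < T)%N -> simplex (u t)) /\
    \sum_(t < T.-1) norm1 (u t.+1 - u t) <= P].

(* Omega carries the internal randomness; the t-tuple lists the pairs of values
   observed in the t previous rounds. Measurability into 'rV[R]_d is
   coordinatewise and joint in the randomness and the observations. *)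
Record bandit_algorithm (R : realType) (d : nat) (disp : measure_display)
    (Omega : measurableType disp) := BanditAlgorithm {
  query_pos : forall t : nat, Omega * t.-tuple (R * R) -> 'rV[R]_d ;
  query_neg : forall t : nat, Omega * t.-tuple (R * R) -> 'rV[R]_d ;
  query_pos_simplex : forall t (wh : Omega * t.-tuple (R * R)), simplex (@query_pos t wh) ;
  query_neg_simplex : forall t (wh : Omega * t.-tuple (R * R)), simplex (@query_neg t wh) ;
  measurable_query_pos : forall t (j : 'I_d),
    measurable_fun setT (fun wh => @query_pos t wh 0 j) ;
  measurable_query_neg : forall t (j : 'I_d),
    measurable_fun setT (fun wh => @query_neg t wh 0 j) }.

Section regret.
Context (R : realType) (d : nat) (disp : measure_display)
  (Omega : measurableType disp) (A : bandit_algorithm R d Omega)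
  (f : nat -> 'rV[R]_d -> R).

Fixpoint history (w : Omega) (t : nat) : t.-tuple (R * R) :=
  match t with
  | 0 => [tuple]
  | s.+1 => [tuple of rcons (history w s)
      (f s (query_pos A (w, history w s)),
       f s (query_neg A (w, history w s)))]
  end.

Definition point_pos (t : nat) (w : Omega) : 'rV[R]_d :=
  query_pos A (w, history w t).

Definition point_neg (t : nat) (w : Omega) : 'rV[R]_d :=
  query_neg A (w, history w t).

Definition regret (T : nat) (P : R) (w : Omega) : R :=
  \sum_(t < T) (f t (point_pos t w) + f t (point_neg t w)) / 2
  - inf [set \sum_(t < T) f t (u t) | u in @comparators R d T P].

End regret.

Definition minimax_regret (R : realType) (d : nat) (G : R) (T : nat) (P : R) :
    \bar R :=
  ereal_inf [set r : \bar R |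
    exists (disp : measure_display) (Omega : measurableType disp)
      (mu : probability Omega R) (A : bandit_algorithm R d Omega),
    r = ereal_sup
      [set 'E_mu[regret A f T P]%E | f in @loss_sequences R d G T]].

(* Main.v *)
(* Only linear losses <z_t, x> are used. The rounds are cut into about 1 + P
   blocks of length n; in each block one coordinate j is secretly better by
   delta ~ sqrt(d / n) on average. The slopes z_t carry independent noise with
   Beta(3, 3) coordinates: it is bounded, which keeps the losses G-Lipschitz,
   and a shift by a vector a costs only O(|a|^2) in Hellinger distance. Two
   evaluations of a linear function do not distinguish the shift of z_t along
   the basis vector e_j from the shift along the projection p_j of e_j on the
   span of the two queries, and sum_j |p_j|^2 <= 2. So the information gained
   about the d candidates is O(delta^2 / d) per round on average, which for the
   above delta does not suffice to find j within the block; every block costs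
   G * delta * n up to a constant.

   The value of a block is computed by backward induction over its rounds, for
   a fixed internal randomness and a fixed past. The loss functions are then
   chosen one round at a time: given the previous ones, some outcome of the
   noise does at least as well as the average, where the average also runs over
   the randomness of the algorithm. *)
From HB Require Import structures.
Require Import Defs.
From mathcomp Require Import all_boot all_order all_algebra.
From mathcomp Require Import all_classical all_reals all_analysis.
From mathcomp Require Import measurable_realfun ring lra.
Import Order.TTheory GRing.Theory Num.Theory.
Import numFieldNormedType.Exports.

Set Implicit Arguments.
Unset Strict Implicit.
Unset Printing Implicit Defensive.

Local Open Scope classical_set_scope.
Local Open Scope ring_scope.

(** * Integrability of real-valued functions *)

Section integrable_real.
Context d (T : measurableType d) {R : realType} (mu : {measure set T -> \bar R}).
Variables (D : set T) (mD : measurable D).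
Implicit Types f g : T -> R.

Lemma integrable_funZ (c : R) f : mu.-integrable D (EFin \o f) ->
  mu.-integrable D (EFin \o (fun x => c * f x)).
Proof. exact: (integrableZl mD c). Qed.

Lemma integrable_funD f g : mu.-integrable D (EFin \o f) ->
  mu.-integrable D (EFin \o g) -> mu.-integrable D (EFin \o (fun x => f x + g x)).
Proof. exact: (integrableD mD). Qed.

Lemma integrable_funB f g : mu.-integrable D (EFin \o f) ->
  mu.-integrable D (EFin \o g) -> mu.-integrable D (EFin \o (fun x => f x - g x)).
Proof. exact: (integrableB mD). Qed.

End integrable_real.

Section probability_integral.
Context d (T : measurableType d) {R : realType} (P : probability T R).

Lemma bounded_integrable (B : R) (f : T -> R) : measurable_fun setT f ->
  (forall x, `|f x| <= B) -> P.-integrable setT (EFin \o f).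
Proof.
move=> mf fB; apply: measurable_bounded_integrable => //.
  by rewrite (le_lt_trans (probability_le1 P measurableT)) ?ltry.
exists B; split; first exact: num_real.
by move=> M BM x _ /=; rewrite (le_trans (fB x))// ltW.
Qed.

Lemma integral_probability_cst (c : \bar R) : (\int[P]_x c = c)%E.
Proof.
rewrite integral_cst//; transitivity (c * 1)%E; last exact: mule1.
by congr (_ * _)%E; exact: probability_setT.
Qed.

End probability_integral.

(** * The Beta(3, 3) noise in one dimension and its shifts *)

Section beta_noise.
Context {R : realType}.
Local Notation mu := (@lebesgue_measure R).

(** The Radon-Nikodym derivative of [beta_prob a b] agrees almost everywhere with [beta_pdf a b],
    since both have the same integral on every measurable set. *)
Lemma ge0_integral_beta_prob (a b : nat) (f : R -> \bar R) :
  measurable_fun setT f -> (forall x, 0 <= f x)%E ->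
  (\int[beta_prob a b]_x f x = \int[mu]_x (f x * (beta_pdf a b x)%:E))%E.
Proof.
move=> mf f0; have dom := beta_prob_dom (R := R) a b.
rewrite -(Radon_Nikodym_SigmaFinite.change_of_variables dom)//.
have iRN := Radon_Nikodym_SigmaFinite.f_integrable dom.
have mpdf := measurable_beta_pdf (R := R) a b.
apply: ae_eq_integral => //.
- by apply: emeasurable_funM => //; exact: measurable_int iRN.
- by apply: emeasurable_funM => //; exact/measurableT_comp.
- apply: ae_eqe_mul2l => /=.
  apply: integral_ae_eq => //=; first exact: measurableT_comp.
  by move=> E _ mE; rewrite -Radon_Nikodym_SigmaFinite.f_integral// integral_beta_pdf.
Qed.

(** The image of Lebesgue measure under the translation agrees with it on half-open intervals, hence
    everywhere by uniqueness. *)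
Lemma ge0_integral_lebesgue_shift (f : R -> \bar R) (a : R) :
  measurable_fun setT f -> (forall x, 0 <= f x)%E ->
  (\int[mu]_x f (x + a)%R = \int[mu]_x f x)%E.
Proof.
move=> mf f0; pose h (x : measurableTypeR R) : measurableTypeR R := x + a.
have mh : measurable_fun setT h by exact: (@measurable_funD _ _ _ setT id (cst a)).
transitivity (\int[pushforward mu h]_x f x)%E.
  by rewrite ge0_integral_pushforward//=.
pose nu : {measure set (measurableTypeR R) -> \bar R} :=
  measure_function_pushforward__canonical__measure_function_Measure mu mh.
apply: (@eq_measure_integral _ _ R setT mu nu) => A mA _.
apply/esym/lebesgue_measure_unique => //.
move=> _ [[x y]] _ <-; change (mu `]x, y] = mu (h @^-1` `]x, y]))%classic.
rewrite (_ : h @^-1` _ = `]x - a, y - a]%classic); last first.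
  by apply/seteqP; split=> z; rewrite /h/= !in_itv/=; lra.
rewrite !lebesgue_measure_itv/= !lte_fin ltrD2r.
by case: ifPn => // _; rewrite -!EFinB; congr EFin; ring.
Qed.

(** Up to a constant factor, the square root of the Beta(3, 3) density on the unit interval. *)
Definition parabola (x : R) := x * (1 - x).
(* The Beta distribution is a measure on [R]: clipping makes the bound on the
   noise hold everywhere, not just almost everywhere. *)
Definition clip01 (x : R) := Num.max 0 (Num.min x 1).
(** Square root of the likelihood ratio of the noise shifted by [a] against the noise itself. The
    maximum handles the points outside the shifted support, where [parabola (x - a)] is not
    positive. *)
Definition shift_ratio (a : R) : R -> R :=
  (fun x => Num.max 0 (parabola (x - a)) / parabola x) \_ `]0, 1[%classic.

Lemma parabola_gt0 x : 0 < x -> x < 1 -> 0 < parabola x.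
Proof. by move=> x0 x1; rewrite mulr_gt0// subr_gt0. Qed.

Lemma parabola_le1 x : parabola x <= 1.
Proof. by have := sqr_ge0 (x - 1 / 2); rewrite /parabola expr2; lra. Qed.

Lemma beta_pdf33 x : beta_pdf 3 3 x = 30 * (if 0 <= x <= 1 then parabola x ^+ 2 else 0) :> R.
Proof.
rewrite /beta_pdf patchE mem_setE in_itv/= beta_funE/=.
case: ifPn => _; last by rewrite mul0r mulr0.
rewrite /XMonemX /parabola -exprMn.
rewrite !factS fact0.
by rewrite mulrC; congr (_ * _); field.
Qed.

Lemma clip01_itv x : 0 <= clip01 x <= 1.
Proof. by rewrite /clip01; rewrite le_max lexx/= ge_max ler01 ge_min lexx orbT. Qed.

Lemma clip01E x : 0 <= x <= 1 -> clip01 x = x.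
Proof. by move=> /andP[x0 x1]; rewrite /clip01 min_l// max_r. Qed.

Lemma measurable_parabola (D : set R) : measurable_fun D parabola.
Proof. by apply: measurable_funM => //; exact: measurable_funB. Qed.

Lemma measurable_clip01 : measurable_fun setT clip01.
Proof. by apply: measurable_maxr => //; exact: measurable_minr. Qed.

Lemma measurable_shift_ratio a : measurable_fun setT (shift_ratio a).
Proof.
apply/measurable_restrict => //; rewrite setTI; apply: measurable_funM => /=.
  apply: measurable_maxr => //; apply: measurableT_comp; first exact: measurable_parabola.
  exact: measurable_funB.
apply: open_continuous_measurable_fun; first exact: interval_open.
move=> x; rewrite inE/= in_itv/= => /andP[x0 x1].
apply: cvgV; first by rewrite gt_eqF// parabola_gt0.
apply: cvgM; first exact: cvg_id.
by apply: cvgB; [exact: cvg_cst|exact: cvg_id].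
Qed.

Lemma shift_ratioE a x : 0 < x -> x < 1 -> shift_ratio a x * parabola x = Num.max 0 (parabola (x - a)).
Proof.
move=> x0 x1; rewrite /shift_ratio patchE mem_setE in_itv/= x0 x1.
by rewrite mulfVK// gt_eqF// parabola_gt0.
Qed.

Lemma shift_ratio_ge0 a x : 0 <= shift_ratio a x.
Proof.
rewrite /shift_ratio patchE mem_setE in_itv/=; case: ifPn => // /andP[x0 x1].
by rewrite divr_ge0 ?le_max ?lexx// ltW// parabola_gt0.
Qed.

Lemma shift_ratio_out a x : ~~ (0 < x < 1) -> shift_ratio a x = 0.
Proof. by rewrite /shift_ratio patchE mem_setE in_itv/= => /negbTE ->. Qed.

Lemma parabola_le0 x : ~~ (0 <= x <= 1) -> parabola x <= 0.
Proof. rewrite negb_and -!ltNge /parabola => /orP[]; nra. Qed.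

(** After translating the variable, both integrals are against Lebesgue measure and compare
    pointwise. There is only an inequality, because the mass that the shift moves out of the support
    is dropped on the left. *)
Lemma beta_shift (a : R) (g : R -> \bar R) :
  measurable_fun setT g -> (forall x, 0 <= g x)%E ->
  (\int[beta_prob 3 3]_x (g (clip01 x) * ((shift_ratio a x) ^+ 2)%:E)
     <= \int[beta_prob 3 3]_x g (clip01 x + a)%R)%E.
Proof.
move=> mg g0.
have mpdf (b : R) : measurable_fun setT (fun x : R => (beta_pdf 3 3 (x - b) : R)%:E).
  apply: measurableT_comp => //; apply: measurableT_comp; first exact: measurable_beta_pdf.
  exact: measurable_funB.
have mu2 : measurable_fun setT (fun x : R => (shift_ratio a x ^+ 2)%:E).
  by apply: measurableT_comp => //; apply: measurable_funX; exact: measurable_shift_ratio.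
have mcl : measurable_fun setT (fun x : R => g (clip01 x)).
  by apply: measurableT_comp => //; exact: measurable_clip01.
have mcla : measurable_fun setT (fun x : R => g (clip01 x + a)).
  by apply: measurableT_comp => //; apply: measurable_funD => //; exact: measurable_clip01.
rewrite !ge0_integral_beta_prob//; [|exact: emeasurable_funM|]; last first.
  by move=> x; rewrite mule_ge0// lee_fin sqr_ge0.
have mgp : measurable_fun setT (fun x : R => g x * (beta_pdf 3 3 (x - a))%:E)%E.
  exact: emeasurable_funM.
(* Translation by [a]; where the density is nonzero, [clip01] is the identity. *)
have -> : (\int[mu]_x (g (clip01 x + a)%R * (beta_pdf 3 3 x)%:E) =
           \int[mu]_x (g x * (beta_pdf 3 3 (x - a)%R)%:E))%E.
  rewrite -(@ge0_integral_lebesgue_shift (fun x => (g x * (beta_pdf 3 3 (x - a)%R)%:E)%E) a).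
  - apply: eq_integral => x _; rewrite addrK beta_pdf33.
    by case: ifPn => [/clip01E -> //|_]; rewrite mulr0 !mule0.
  - exact: mgp.
  - by move=> x; rewrite mule_ge0// lee_fin beta_pdf_ge0.
apply: ge0_le_integral => //=.
- by move=> x _; rewrite !mule_ge0// ?lee_fin ?sqr_ge0 ?beta_pdf_ge0.
- apply: emeasurable_funM; first exact: emeasurable_funM.
  by apply/measurable_EFinP; exact: measurable_beta_pdf.
move=> x _; have [/andP[x0 x1]|x01] := boolP (0 < x < 1); last first.
  by rewrite shift_ratio_out// expr0n/= mule0 mul0e mule_ge0// lee_fin beta_pdf_ge0.
rewrite clip01E ?(ltW x0) ?(ltW x1)// -muleA; apply: lee_wpmul2l; first exact: g0.
rewrite -EFinM lee_fin !beta_pdf33 (ltW x0) (ltW x1)/= mulrCA -exprMn shift_ratioE//.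
case: ifPn => xa; last by rewrite max_l ?expr0n ?mulr0// parabola_le0.
by rewrite max_r//; move: xa => /andP[? ?]; rewrite mulr_ge0// subr_ge0.
Qed.

Lemma Rintegral_XMonemX m n :
  \int[mu]_(x in `[0, 1]) XMonemX m n x = beta_fun m.+1 n.+1 :> R.
Proof. by rewrite /beta_fun -Rintegral_mkcond. Qed.

(** Dropping the maximum bounds the integrand from below by the polynomial
    [30 * parabola (x - a) * parabola x]. Its constant term in [a] integrates to 1, its linear term
    to 0 by the symmetry of [x] and [1 - x], and its quadratic term to [- 5 * a ^+ 2], as 30 B(2, 2)
    = 5. *)
Lemma beta_affinity (a : R) :
  ((1 - 5 * a ^+ 2)%:E <= \int[beta_prob 3 3]_x (shift_ratio a x)%:E)%E.
Proof.
have mf b : measurable_fun setT (fun x : R => parabola (x - b)).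
  by apply: measurableT_comp; [exact: measurable_parabola|exact: measurable_funB].
rewrite ge0_integral_beta_prob//; last 2 first.
- by apply/measurable_EFinP; exact: measurable_shift_ratio.
- by move=> x; rewrite lee_fin shift_ratio_ge0.
pose k x : R := 30 * (Num.max 0 (parabola (x - a)) * parabola x).
(* At the endpoints the left side vanishes because [shift_ratio] is 0 off the open interval, and [k]
   because [parabola] is 0. *)
have kE (x : R) : shift_ratio a x * beta_pdf 3 3 x = if 0 <= x <= 1 then k x else 0.
  rewrite beta_pdf33 /k; case: ifPn => [/andP[x0 x1]|_]; last by rewrite !mulr0.
  have [/andP[x0' x1']|x01] := boolP (0 < x < 1).
    by rewrite -shift_ratioE//; ring.
  rewrite shift_ratio_out// mul0r (_ : parabola x = 0) ?mulr0//.
  move: x01; rewrite negb_and -!leNgt /parabola => /orP[] ?.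
    by rewrite (_ : x = 0) ?mul0r//; lra.
  by rewrite (_ : x = 1) ?subrr ?mulr0//; lra.
have -> : (\int[mu]_x ((shift_ratio a x)%:E * (beta_pdf 3 3 x)%:E) =
           \int[mu]_(x in `[0%R, 1%R]) (k x)%:E)%E.
  rewrite [RHS]integral_mkcond; apply: eq_integral => x _ /=.
  by rewrite patchE mem_setE in_itv/= -EFinM kE; case: ifPn.
have ik : mu.-integrable `[0, 1] (EFin \o k).
  apply: measurable_bounded_integrable => //.
  - by rewrite /= lebesgue_measure_itv/= lte01 -EFinB ltry.
  - apply: measurable_funM => //; apply: measurable_funM; last exact: measurable_parabola.
    by apply: measurable_maxr => //; apply: measurable_funS (mf a).
  - exists 30; split; first exact: num_real.
    move=> M M30 x /=; rewrite in_itv/= => /andP[x0 x1].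
    have m1 : Num.max 0 (parabola (x - a)) <= 1.
      by rewrite ge_max ler01 parabola_le1.
    have m0 : 0 <= Num.max 0 (parabola (x - a)) by rewrite le_max lexx.
    have p0 : 0 <= parabola x by rewrite mulr_ge0// subr_ge0.
    have p1 := parabola_le1 x.
    by rewrite /k ger0_norm ?mulr_ge0//; nra.
(* The expansion of the polynomial in powers of [a], each coefficient being a combination of Beta
   integrands. *)
pose h x : R := 30 * (XMonemX 2 2 x + a * (XMonemX 2 1 x - XMonemX 1 2 x)
   - a ^+ 2 * XMonemX 1 1 x).
have iX m n := @integrable_XMonemX R m n.
have i1 : mu.-integrable `[0, 1] (EFin \o (fun x => XMonemX 2 1 x - XMonemX 1 2 x : R)).
  exact: integrable_funB.
have i2 : mu.-integrable `[0, 1] (EFin \o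
    (fun x => XMonemX 2 2 x + a * (XMonemX 2 1 x - XMonemX 1 2 x))).
  by apply: integrable_funD => //; exact: integrable_funZ.
have i3 : mu.-integrable `[0, 1] (EFin \o (fun x => XMonemX 2 2 x +
    a * (XMonemX 2 1 x - XMonemX 1 2 x) - a ^+ 2 * XMonemX 1 1 x)).
  by apply: integrable_funB => //; exact: integrable_funZ.
have ih : mu.-integrable `[0, 1] (EFin \o h) by exact: integrable_funZ.
have -> : 1 - 5 * a ^+ 2 = \int[mu]_(x in `[0, 1]) h x.
  rewrite RintegralZl// RintegralB//; last exact: integrable_funZ.
  rewrite RintegralD//; last exact: integrable_funZ.
  rewrite !RintegralZl//.
  rewrite RintegralB// !Rintegral_XMonemX !beta_funE/= !factS fact0.
  by field.
rewrite /Rintegral fineK; last exact: integrable_fin_num.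
apply: le_integral => //= x; rewrite inE/= in_itv/= => /andP[x0 x1].
rewrite lee_fin /h /k /XMonemX ler_pM2l//.
have p0 : 0 <= parabola x by rewrite mulr_ge0// subr_ge0.
apply: (@le_trans _ _ (parabola (x - a) * parabola x)).
  by rewrite le_eqVlt; apply/orP; left; apply/eqP; rewrite /parabola /unstable.onem; ring.
by rewrite ler_wpM2r// le_max lexx orbT.
Qed.

End beta_noise.

(** * Noise vectors with independent coordinates *)

Section product_noise.
Context {R : realType}.

Definition dotf k (c y : 'I_k -> R) : R := \sum_i c i * y i.

(* [u ^ 2] is the density, with respect to the noise, of the part of the noise
   shifted by [a] that stays in the support of the noise, and [\int u] is the
   Hellinger affinity. Only two linear functionals of the noise vector are ever
   observed, hence the form of the last clause. *)
Definition noise_shift d (E : measurableType d) (nu : probability E R) k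
    (xi : 'I_k -> E -> R) (a : 'I_k -> R) (u : E -> R) :=
  [/\ measurable_fun setT u, forall e, 0 <= u e,
    ((1 - 5 * \sum_i a i ^+ 2)%:E <= \int[nu]_e (u e)%:E)%E &
    forall (al be : 'I_k -> R) (g : R * R -> \bar R),
      measurable_fun setT g -> (forall y, 0 <= g y)%E ->
      (\int[nu]_e (g (dotf al (xi ^~ e), dotf be (xi ^~ e)) * (u e ^+ 2)%:E)
       <= \int[nu]_e g (dotf al (fun i => xi i e + a i)%R,
                        dotf be (fun i => xi i e + a i)%R))%E].

(** The common mean [m] makes the unshifted linear loss constant on the simplex on average, so that
    only the hidden shift distinguishes the vertices. *)
Definition is_noise d (E : measurableType d) (nu : probability E R) k
    (xi : 'I_k -> E -> R) (m : R) :=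
  [/\ forall i, measurable_fun setT (xi i), forall i e, 0 <= xi i e <= 1,
    forall i, (\int[nu]_e (xi i e)%:E)%E = m%:E &
    forall a, exists u, noise_shift nu xi a u].

(** Induction on the dimension, with one more independent clipped Beta variable at each step. The
    ratios of the coordinates multiply, so affinities multiply as well, and the shift inequality is
    obtained one factor at a time by Tonelli. *)
Lemma is_noise_exists : exists m : R, forall k : nat,
  exists d (E : measurableType d) (nu : probability E R) (xi : 'I_k -> E -> R),
    is_noise nu xi m.
Proof.
pose b : probability (measurableTypeR R) R := beta_prob 3 3.
have mclip := @measurable_clip01 R.
have iclip : b.-integrable setT (EFin \o @clip01 R).
  apply: (@bounded_integrable _ _ _ _ 1) => // x.
  by have /andP[c0 c1] := clip01_itv x; rewrite ger0_norm.
exists (fine (\int[b]_x (clip01 x)%:E)%E) => k.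
elim: k => [|k [d [E [nu [xi [mxi xi01 Exi xia]]]]]].
  exists _, (measurableTypeR R), b, (fun _ => cst 0); split; [by case|by case|by case|move=> a].
  exists (cst 1); split => //.
  - by rewrite big_ord0 mulr0 subr0 /= (integral_probability_cst b).
  - move=> al be g mg g0; rewrite le_eqVlt; apply/orP; left; apply/eqP.
    by apply: eq_integral => x _; rewrite /dotf !big_ord0 expr1n mule1.
pose xi' (i : 'I_k.+1) (p : measurableTypeR R * E) : R :=
  if unlift ord0 i is Some j then xi j p.2 else clip01 p.1.
have xi0 p : xi' ord0 p = clip01 p.1 by rewrite /xi' unlift_none.
have xiS j p : xi' (lift ord0 j) p = xi j p.2 by rewrite /xi' liftK.
have mxi' i : measurable_fun setT (xi' i).
  rewrite /xi'; case: unliftP => [j _|_]; first exact: measurableT_comp.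
  exact: measurableT_comp.
exists _, (measurableTypeR R * E)%type, (b \x nu)%E, xi'; split => //.
- by move=> i e; rewrite /xi'; case: unliftP => [j _|_]; [exact: xi01|exact: clip01_itv].
- move=> i; rewrite fubini_tonelli1//=; last 2 first.
  + by apply/measurable_EFinP.
  + by move=> p; rewrite lee_fin /xi'; case: unliftP => [j _|_];
      [have /andP[] := xi01 j p.2|have /andP[] := clip01_itv p.1].
  rewrite /fubini_F /xi' /=; case: unliftP => [j _|_] /=.
    under eq_integral do rewrite Exi.
    by rewrite integral_probability_cst.
  under eq_integral do rewrite integral_probability_cst.
  by rewrite fineK//; exact: integrable_fin_num.
move=> a; have [u [mu u0 Eu shu]] := xia (a \o lift ord0).
pose w : R -> R := shift_ratio (a ord0).
have mw : measurable_fun setT w by exact: measurable_shift_ratio.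
have w0 x : 0 <= w x by exact: shift_ratio_ge0.
exists (fun p => w p.1 * u p.2); split.
- by apply: measurable_funM; exact: measurableT_comp.
- by move=> e; rewrite mulr_ge0.
- rewrite fubini_tonelli1//=; last 2 first.
  + by apply/measurable_EFinP; apply: measurable_funM; exact: measurableT_comp.
  + by move=> p; rewrite lee_fin mulr_ge0.
  rewrite /fubini_F /=.
  under eq_integral => x _.
    under eq_integral do rewrite EFinM.
    rewrite ge0_integralZl//; last 3 first.
    + exact/measurable_EFinP.
    + by move=> y _; rewrite lee_fin.
    + by rewrite lee_fin.
    over.
  have Iu0 : (0 <= \int[nu]_e (u e)%:E)%E by apply: integral_ge0 => e _; rewrite lee_fin.
  rewrite ge0_integralZr//; last 2 first.
    + exact/measurable_EFinP.
    + by move=> y _; rewrite lee_fin.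
  have Ew := @beta_affinity R (a ord0).
  rewrite big_ord_recl mulrDr.
  set s := 5 * a ord0 ^+ 2; set t := 5 * _.
  have s0 : 0 <= s by rewrite mulr_ge0// sqr_ge0.
  have t0 : 0 <= t by rewrite mulr_ge0// sumr_ge0// => i _; rewrite sqr_ge0.
  (* If [s + t > 1] the claimed bound is negative; otherwise [(1 - s) * (1 - t) >= 1 - (s + t)]. *)
  have [st|st] := leP (s + t) 1; last first.
    apply: (@le_trans _ _ 0%E); first by rewrite lee_fin; lra.
    by rewrite mule_ge0//; apply: integral_ge0 => x _; rewrite lee_fin.
  apply: (@le_trans _ _ ((1 - s)%:E * (1 - t)%:E)%E).
    by rewrite -EFinM lee_fin; nra.
  by apply: lee_pmul => //; rewrite lee_fin; lra.
- move=> al be g mg g0.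
  pose lin (c : 'I_k.+1 -> R) (y : 'I_k -> R) (x : R) :=
    c ord0 * x + dotf (c \o lift ord0) y.
  have linE c y : dotf c y = lin c (y \o lift ord0) (y ord0).
    by rewrite /lin /dotf big_ord_recl.
  have mlin e' (E' : measurableType e') c (y : 'I_k -> E' -> R) (x : E' -> R) :
      (forall i, measurable_fun setT (y i)) -> measurable_fun setT x ->
      measurable_fun setT (fun e => lin c (y ^~ e) (x e)).
    move=> my mx; apply: measurable_funD; first exact: measurable_funM.
    by apply: measurable_sum => i; exact: measurable_funM.
  pose G (y : 'I_k -> R) (x : R) := g (lin al y x, lin be y x).
  have mG e' (E' : measurableType e') (y : 'I_k -> E' -> R) (x : E' -> R) :
      (forall i, measurable_fun setT (y i)) -> measurable_fun setT x ->
      measurable_fun setT (fun e => G (y ^~ e) (x e)).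
    move=> my mx; apply: measurableT_comp => //.
    by apply/measurable_fun_pair => /=; exact: mlin.
  have G0 y x : (0 <= G y x)%E by exact: g0.
  have mxa i : measurable_fun setT (fun e => xi i e + a (lift ord0 i)).
    exact: measurable_funD.
  have msq e' (E' : measurableType e') (f : E' -> R) :
      measurable_fun setT f -> measurable_fun setT (fun e => (f e ^+ 2)%:E).
    by move=> mf; apply/measurable_EFinP; exact: measurable_funX.
  have sq0 (r : R) : (0 <= (r ^+ 2)%:E)%E by rewrite lee_fin sqr_ge0.
  (* The hybrid between the two sides: the old coordinates are already shifted, the new one is still
     reweighted. Going from [L] to [F] uses the induction hypothesis for a fixed new coordinate;
     going from [F] to [M] uses [beta_shift] for fixed old ones. *)
  pose F (p : measurableTypeR R * E) :=
    (G (fun i => xi i p.2 + a (lift ord0 i))%R (clip01 p.1) * (w p.1 ^+ 2)%:E)%E.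
  have mF : measurable_fun setT F.
    apply: emeasurable_funM; last by apply: msq; exact: measurableT_comp.
    by apply: mG => [i|]; [exact: (measurableT_comp (mxa i))|exact: measurableT_comp].
  have F0 p : (0 <= F p)%E by rewrite mule_ge0.
  pose L (p : measurableTypeR R * E) :=
    (g (dotf al (xi' ^~ p), dotf be (xi' ^~ p)) * ((w p.1 * u p.2) ^+ 2)%:E)%E.
  have mL : measurable_fun setT L.
    apply: emeasurable_funM; last first.
      by apply: msq; apply: measurable_funM; exact: measurableT_comp.
    apply: measurableT_comp => //; apply/measurable_fun_pair => /=.
      by apply: measurable_sum => i; exact: measurable_funM.
    by apply: measurable_sum => i; exact: measurable_funM.
  have L0 p : (0 <= L p)%E by rewrite mule_ge0.
  pose M (p : measurableTypeR R * E) :=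
    g (dotf al (fun i => xi' i p + a i)%R, dotf be (fun i => xi' i p + a i)%R).
  have mM : measurable_fun setT M.
    apply: measurableT_comp => //; apply/measurable_fun_pair => /=.
      by apply: measurable_sum => i; apply: measurable_funM => //; exact: measurable_funD.
    by apply: measurable_sum => i; apply: measurable_funM => //; exact: measurable_funD.
  have M0 p : (0 <= M p)%E by exact: g0.
  rewrite -[leLHS]/(\int[(b \x nu)%E]_p L p)%E (fubini_tonelli1 L mL L0).
  rewrite -[leRHS]/(\int[(b \x nu)%E]_p M p)%E (fubini_tonelli1 M mM M0).
  apply: (@le_trans _ _ (\int[b]_x \int[nu]_e F (x, e))%E).
    apply: ge0_le_integral => //.
    + by move=> x _; apply: integral_ge0 => e _.
    + exact: measurable_fun_fubini_tonelli_F.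
    + exact: (measurable_fun_fubini_tonelli_F F).
    move=> x _; rewrite /fubini_F /F /=.
    have gx y : (0 <= g (al ord0 * clip01 x + y.1, be ord0 * clip01 x + y.2)%R)%E by exact: g0.
    have mgx : measurable_fun setT (fun y : R * R =>
        g (al ord0 * clip01 x + y.1, be ord0 * clip01 x + y.2)%R).
      apply: measurableT_comp => //.
      by apply/measurable_fun_pair => /=; exact: measurable_funD.
    have mg1 : measurable_fun setT (fun e => g (al ord0 * clip01 x + dotf (al \o lift ord0) (xi ^~ e),
        be ord0 * clip01 x + dotf (be \o lift ord0) (xi ^~ e))%R).
      exact: (mG _ _ _ (cst (clip01 x))).
    have mg2 : measurable_fun setT (fun e => g (al ord0 * clip01 x +
          dotf (al \o lift ord0) (fun i => xi i e + a (lift ord0 i)),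
        be ord0 * clip01 x +
          dotf (be \o lift ord0) (fun i => xi i e + a (lift ord0 i)))%R).
      exact: (mG _ _ (fun i e => xi i e + a (lift ord0 i)) (cst (clip01 x))).
    have -> : (\int[nu]_e L (x, e) = (w x ^+ 2)%:E * \int[nu]_e
        (g (al ord0 * clip01 x + dotf (al \o lift ord0) (xi ^~ e),
            be ord0 * clip01 x + dotf (be \o lift ord0) (xi ^~ e))%R * (u e ^+ 2)%:E))%E.
      rewrite -ge0_integralZl//; last 2 first.
      + by apply: emeasurable_funM => //; exact: msq.
      + by move=> e _; rewrite mule_ge0.
      apply: eq_integral => e _; rewrite /L !linE /lin xi0 /= exprMn EFinM muleCA.
      by congr (_ * (g (_, _) * _))%E; congr (_ + _); apply: eq_bigr => i _ /=; rewrite xiS.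
    under [leRHS]eq_integral do rewrite /G /lin /= muleC.
    rewrite ge0_integralZl//.
    apply: lee_wpmul2l => //.
    exact: (shu (al \o lift ord0) (be \o lift ord0) _ mgx gx).
  have -> : (\int[b]_x \int[nu]_e F (x, e) = \int[nu]_e \int[b]_x F (x, e))%E.
    exact: fubini_tonelli.
  have -> : (\int[b]_x \int[nu]_e M (x, e) = \int[nu]_e \int[b]_x M (x, e))%E.
    exact: fubini_tonelli.
  apply: ge0_le_integral => //.
  - by move=> e _; apply: integral_ge0 => x _.
  - exact: (measurable_fun_fubini_tonelli_G F).
  - exact: (measurable_fun_fubini_tonelli_G M).
  move=> e _.
  pose s := dotf (al \o lift ord0) (fun i => xi i e + a (lift ord0 i)).
  pose t := dotf (be \o lift ord0) (fun i => xi i e + a (lift ord0 i)).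
  have -> : (\int[b]_x M (x, e) =
      \int[b]_x g (al ord0 * (clip01 x + a ord0) + s, be ord0 * (clip01 x + a ord0) + t)%R)%E.
    apply: eq_integral => x _; rewrite /M !linE /lin xi0 /=.
    by congr (g (_, _)); congr (_ + _); apply: eq_bigr => i _ /=; rewrite xiS.
  apply: (beta_shift (a ord0) (g := fun y => g (al ord0 * y + s, be ord0 * y + t)%R)).
    apply: measurableT_comp => //; apply/measurable_fun_pair => /=;
      by apply: measurable_funD => //; exact: measurable_funM.
  by [].
Qed.

End product_noise.

(** * Real-valued integrals under a probability, and Fubini for bounded functions *)

Section Rintegral_probability.
Context d (T : measurableType d) {R : realType} (P : probability T R).

Lemma Rintegral_probability_cst (c : R) : \int[P]_x c = c.
Proof. by rewrite /Rintegral integral_probability_cst. Qed.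

(** Both sides of the one-round inequality in the analysis of a block have this form. *)
Lemma integrable_fun_lin3 (c k1 k2 k3 : R) (f1 f2 f3 : T -> R) :
  P.-integrable setT (EFin \o f1) -> P.-integrable setT (EFin \o f2) ->
  P.-integrable setT (EFin \o f3) ->
  P.-integrable setT (EFin \o (fun x => c + k1 * f1 x + k2 * f2 x + k3 * f3 x)) /\
  \int[P]_x (c + k1 * f1 x + k2 * f2 x + k3 * f3 x) =
    c + k1 * \int[P]_x f1 x + k2 * \int[P]_x f2 x + k3 * \int[P]_x f3 x.
Proof.
move=> I1 I2 I3.
have Ic : P.-integrable setT (EFin \o (fun=> c)).
  by apply: (@bounded_integrable _ _ _ _ `|c|).
have Z (k : R) f : P.-integrable setT (EFin \o f) ->
    P.-integrable setT (EFin \o (fun x => k * f x)) by exact: integrable_funZ.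
have Ic1 : P.-integrable setT (EFin \o (fun x => c + k1 * f1 x)).
  by apply: integrable_funD => //; exact: Z.
have Ic2 : P.-integrable setT (EFin \o (fun x => c + k1 * f1 x + k2 * f2 x)).
  by apply: integrable_funD => //; exact: Z.
split; first by apply: integrable_funD => //; exact: Z.
rewrite RintegralD//; last exact: Z.
rewrite RintegralD//; last exact: Z.
rewrite RintegralD//; last exact: Z.
by rewrite !RintegralZl// Rintegral_probability_cst.
Qed.

Lemma integrable_fun_sum I (s : seq I) (f : I -> T -> R) :
  (forall i, P.-integrable setT (EFin \o f i)) ->
  P.-integrable setT (EFin \o (fun x => \sum_(i <- s) f i x)).
Proof.
move=> fi.
apply: (eq_integrable measurableT (fun x => \sum_(i <- s) (EFin \o f i) x)%E).
  by move=> x _; rewrite /= sumEFin.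
by apply: integrable_sum.
Qed.

Lemma Rintegral_sum I (s : seq I) (f : I -> T -> R) :
  (forall i, P.-integrable setT (EFin \o f i)) ->
  \int[P]_x (\sum_(i <- s) f i x) = \sum_(i <- s) \int[P]_x f i x.
Proof.
move=> fi; elim: s => [|i s ih].
  by under eq_Rintegral do rewrite big_nil; rewrite Rintegral_probability_cst big_nil.
rewrite big_cons -ih -RintegralD//; last exact: integrable_fun_sum.
by apply: eq_Rintegral => x _; rewrite big_cons.
Qed.

Lemma Rintegral_itv (f : T -> R) (B : R) : measurable_fun setT f ->
  (forall x, 0 <= f x <= B) -> 0 <= \int[P]_x f x <= B.
Proof.
move=> mf fB; have f0 x : 0 <= f x by have /andP[] := fB x.
rewrite Rintegral_ge0//=.
rewrite -[leRHS](Rintegral_probability_cst B); apply: le_Rintegral => //.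
- by apply: (@bounded_integrable _ _ _ _ B) => // x; rewrite ger0_norm//; have /andP[] := fB x.
- by apply: (@bounded_integrable _ _ _ _ `|B|).
- by move=> x _; have /andP[] := fB x.
Qed.

(** Otherwise [c - f] would be positive everywhere with integral at most 0, hence zero almost
    everywhere, which is impossible on a space of mass 1. This is what makes the choice of a
    deterministic loss possible. *)
Lemma Rintegral_le_witness (f : T -> R) (c : R) : P.-integrable setT (EFin \o f) ->
  c <= \int[P]_x f x -> exists x, c <= f x.
Proof.
move=> If cf; apply: contrapT => /forallNP fc.
have {}fc x : f x < c by rewrite ltNge; exact/negP/fc.
have Ic : P.-integrable setT (EFin \o (fun=> c)).
  by apply: (@bounded_integrable _ _ _ _ `|c|).
have Ig : P.-integrable setT (EFin \o (fun x => c - f x)) by exact: integrable_funB.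
have I0 : (\int[P]_x `|(c - f x)%:E| = 0)%E.
  under eq_integral => x _ do rewrite /= ger0_norm ?subr_ge0 ?ltW//.
  apply/eqP; rewrite eq_le; apply/andP; split; last first.
    by apply: integral_ge0 => x _; rewrite lee_fin subr_ge0 ltW.
  rewrite -[leLHS]fineK; last exact: integrable_fin_num.
  by rewrite lee_fin -/(Rintegral _ _ _) RintegralB// Rintegral_probability_cst subr_le0.
have [mg _] := integrableP _ _ _ Ig.
have /(ae_eq_integral_abs P measurableT mg) := I0.
move=> [N [mN N0 sub]].
have NT : N = setT.
  apply/seteqP; split=> // x _; apply: sub => /= /(_ I) /= [cfx].
  by have := fc x; rewrite -subr_gt0 cfx ltxx.
by have := probability_setT P; rewrite -NT N0 => /esym/eqP; rewrite onee_eq0.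
Qed.

End Rintegral_probability.

Lemma measurable_Rintegral_snd d1 d2 (T1 : measurableType d1) (T2 : measurableType d2)
    (R : realType) (P : probability T2 R) (f : T1 * T2 -> R) :
  measurable_fun setT f -> (forall x, 0 <= f x) ->
  measurable_fun setT (fun x => \int[P]_y f (x, y)).
Proof.
move=> mf f0; apply: (measurableT_comp (f := fine)) => //.
apply: (measurable_fun_fubini_tonelli_F (EFin \o f)); first exact/measurable_EFinP.
by move=> x; rewrite lee_fin.
Qed.

Section Rintegral_fubini.
Context d1 d2 (T1 : measurableType d1) (T2 : measurableType d2) {R : realType}.
Variables (P1 : probability T1 R) (P2 : probability T2 R).
Variables (B : R) (f : T1 * T2 -> R).
Hypotheses (mf : measurable_fun setT f) (fB : forall x, `|f x| <= B).

Let mfE : measurable_fun setT (EFin \o f).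
Proof. exact/measurable_EFinP. Qed.

Let If : (P1 \x P2)%E.-integrable setT (EFin \o f).
Proof. exact: (@bounded_integrable _ _ _ _ B). Qed.

Let fin1 x : (\int[P2]_y (f (x, y))%:E)%E = (\int[P2]_y f (x, y))%:E.
Proof.
rewrite /Rintegral fineK//; apply: integrable_fin_num => //.
by apply: (@bounded_integrable _ _ _ _ B) => //; exact: measurableT_comp.
Qed.

Let fin2 y : (\int[P1]_x (f (x, y))%:E)%E = (\int[P1]_x f (x, y))%:E.
Proof.
rewrite /Rintegral fineK//; apply: integrable_fin_num => //.
by apply: (@bounded_integrable _ _ _ _ B) => //; exact: measurableT_comp.
Qed.

Lemma integrable_Rintegral_fst :
  P2.-integrable setT (EFin \o (fun y => \int[P1]_x f (x, y))).
Proof.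
apply: (@bounded_integrable _ _ _ _ B) => [|y].
  apply/measurable_EFinP; rewrite (_ : _ \o _ = fun y => \int[P1]_x (f (x, y))%:E)%E.
    exact: (measurable_fubini_G If).
  by apply/funext => y /=; rewrite fin2.
have my : measurable_fun setT (fun x => f (x, y)) by exact: measurableT_comp.
apply: le_trans (le_normr_Rintegral _ _) _ => //.
  exact: (@bounded_integrable _ _ _ _ B).
have /andP[_ //] : 0 <= \int[P1]_x `|f (x, y)| <= B.
by apply: Rintegral_itv => [|x]; [exact: measurableT_comp|rewrite normr_ge0 fB].
Qed.

Lemma Rintegral_swap :
  \int[P1]_x \int[P2]_y f (x, y) = \int[P2]_y \int[P1]_x f (x, y).
Proof.
rewrite {1 3}/Rintegral; congr fine.
under eq_integral do rewrite -fin1.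
under [RHS]eq_integral do rewrite -fin2.
exact: (Fubini If).
Qed.

End Rintegral_fubini.

(** * The shift inequalities for real-valued integrals *)

Section noise_real.
Context {R : realType} d (E : measurableType d) (nu : probability E R).
Context k (xi : 'I_k -> E -> R) (a : 'I_k -> R) (u : E -> R).
Hypotheses (mxi : forall i, measurable_fun setT (xi i)) (su : noise_shift nu xi a u).

Let mu2 : measurable_fun setT (fun e => u e ^+ 2).
Proof. by case: su => mu _ _ _; exact: measurable_funX. Qed.

(** The shift inequality for the constant function 1: the retained part of the shifted noise has
    mass at most 1. *)
Let intu2 : (\int[nu]_e (u e ^+ 2)%:E <= 1)%E.
Proof.
case: su => mu u0 _ /(_ (fun _ => 0) (fun _ => 0) (cst 1%E)) /= sh.
rewrite -[leRHS](integral_probability_cst nu).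
apply: le_trans (sh _ _) => //; under [leRHS]eq_integral do rewrite mul1e.
by [].
Qed.

Lemma integrable_noise_sqr : nu.-integrable setT (EFin \o (fun e => u e ^+ 2)).
Proof.
apply/integrableP; split; first exact/measurable_EFinP.
under eq_integral => e _ do rewrite /= ger0_norm ?sqr_ge0//.
by apply: le_lt_trans intu2 _; rewrite ltry.
Qed.

Lemma integrable_noise_ratio : nu.-integrable setT (EFin \o u).
Proof.
case: su => mu u0 _ _.
have i1 : nu.-integrable setT (EFin \o (fun e => 1 + u e ^+ 2)).
  apply: integrable_funD => //; last exact: integrable_noise_sqr.
  by apply: (@bounded_integrable _ _ _ _ 1) => // x; rewrite normr1.
apply: le_integrable i1 => //; first exact/measurable_EFinP.
move=> e _ /=; rewrite lee_fin !ger0_norm ?addr_ge0 ?sqr_ge0//.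
by have := sqr_ge0 (u e - 1); have := sqr_ge0 (u e); rewrite sqrrB expr1n mulr1 mulr2n; lra.
Qed.

Lemma Rintegral_noise_sqr : \int[nu]_e (u e ^+ 2) <= 1.
Proof.
rewrite -lee_fin /Rintegral fineK ?integrable_fin_num//; exact: integrable_noise_sqr.
Qed.

Lemma Rintegral_noise_ratio : 1 - 5 * \sum_i a i ^+ 2 <= \int[nu]_e u e.
Proof.
rewrite -lee_fin /Rintegral fineK; first by case: su.
exact/integrable_fin_num/integrable_noise_ratio.
Qed.

Variables (B : R) (h : R * R -> R) (al be : 'I_k -> R).
Hypotheses (mh : measurable_fun setT h) (hB : forall y, 0 <= h y <= B).

Let obs (y : 'I_k -> R) := (dotf al y, dotf be y).

Lemma measurable_dotf_pair (b : 'I_k -> R) :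
  measurable_fun setT (fun e => obs (fun i => xi i e + b i)).
Proof.
by apply/measurable_fun_pair => /=; apply: measurable_sum => i;
  apply: measurable_funM => //; exact: measurable_funD.
Qed.

Let mh0 : measurable_fun setT (fun e => h (obs (xi ^~ e))).
Proof.
apply: measurableT_comp => //.
rewrite (_ : (fun e => _) = fun e => obs (fun i => xi i e + 0)).
  exact: (measurable_dotf_pair (fun=> 0)).
by apply/funext => e; congr obs; apply/funext => i; rewrite addr0.
Qed.

Lemma integrable_noise_obs :
  nu.-integrable setT (EFin \o (fun e => h (obs (xi ^~ e)) * u e ^+ 2)).
Proof.
apply: (le_integrable measurableT _ _ (integrable_funZ measurableT B integrable_noise_sqr)).
  by apply/measurable_EFinP; exact: measurable_funM.
move=> e _ /=; have /andP[h0 hb] := hB (obs (xi ^~ e)).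
have u2 := sqr_ge0 (u e).
by rewrite lee_fin !ger0_norm ?(mulr_ge0 _ u2) ?(le_trans h0 hb)// ler_wpM2r.
Qed.

Lemma Rintegral_noise_obs :
  \int[nu]_e (h (obs (xi ^~ e)) * u e ^+ 2) <=
  \int[nu]_e h (obs (fun i => xi i e + a i)).
Proof.
have I2 : nu.-integrable setT (EFin \o (fun e => h (obs (fun i => xi i e + a i)))).
  apply: (@bounded_integrable _ _ _ _ B) => [|e].
    by apply: measurableT_comp => //; exact: measurable_dotf_pair.
  by have /andP[h0 hb] := hB (obs (fun i => xi i e + a i)); rewrite ger0_norm.
rewrite -lee_fin /Rintegral !fineK; last 2 first.
- exact: integrable_fin_num.
- exact/integrable_fin_num/integrable_noise_obs.
case: su => _ _ _ /(_ al be (EFin \o h)) /=; apply; first exact/measurable_EFinP.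
by move=> y; rewrite lee_fin; have /andP[] := hB y.
Qed.

End noise_real.

(** * Inequalities for the logarithm *)

Section logarithm.
Context {R : realType}.
Implicit Types m u x : R.

Lemma ln_le_subr1 x : 0 < x -> ln x <= x - 1.
Proof. by move=> x0; have := expR_ge1Dx (ln x); rewrite lnK//; lra. Qed.

(* A linearized form of Pinsker's inequality: [1 - m] is at most 1/3 plus twice
   the integrand [m - 1 - ln m] of the relative entropy. *)
Lemma onem_le_ln m : 0 < m -> 1 - m <= 1 / 3 + 2 * (m - 1 - ln m).
Proof.
move=> m0.
(* The difference of the two sides is smallest at [m = 2 / 3], so the logarithm is replaced by its
   tangent there. *)
have h1 : ln (3 / 2 * m) <= 3 / 2 * m - 1 by apply: ln_le_subr1; rewrite mulr_gt0.
have h2 : ln (2 / 3) <= 2 / 3 - 1 :> R by apply: ln_le_subr1; rewrite divr_gt0.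
have h3 : ln m = ln (3 / 2 * m) + ln (2 / 3).
  by rewrite -lnM ?posrE ?mulr_gt0 ?divr_gt0//; congr ln; field.
lra.
Qed.

(** Since [(1 + u ^+ 2) / 2 >= ((1 + u) / 2) ^+ 2], the bound [ln y >= 1 - 1 / y] at
    [y = (1 + u) / 2] suffices. It turns the expected logarithm of a one-round likelihood ratio into
    the affinity: if [u ^+ 2] has mean at most 1 and [u] has mean at least [1 - s], the result is at
    least [- 3 * s]. *)
Lemma ln_mid_sqr u : 0 <= u -> 3 * u - u ^+ 2 - 2 <= ln ((1 + u ^+ 2) / 2).
Proof.
move=> u0; have u1 : 0 < 1 + u by lra.
have y0 : 0 < (1 + u) / 2 by rewrite divr_gt0.
have h : ln ((1 + u) / 2) >= 1 - 2 / (1 + u).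
  have := ln_le_subr1 (x := ((1 + u) / 2)^-1); rewrite invr_gt0 => /(_ y0).
  by rewrite lnV ?posrE// invf_div; lra.
apply: (@le_trans _ _ (ln (((1 + u) / 2) ^+ 2))); last first.
  rewrite ler_ln ?posrE ?exprn_gt0//.
    by rewrite -subr_ge0 (_ : _ - _ = ((u - 1) / 2) ^+ 2) ?sqr_ge0//; field.
  by rewrite divr_gt0// ltr_pwDl// sqr_ge0.
rewrite lnXn// mulr2n.
suff : 3 * u - u ^+ 2 - 2 <= 2 * (1 - 2 / (1 + u)) by lra.
rewrite -subr_ge0 (_ : _ - _ = u * (u - 1) ^+ 2 / (1 + u)); last by field; lra.
by rewrite divr_ge0 ?(ltW u1)// mulr_ge0 ?sqr_ge0.
Qed.

End logarithm.

(** * Projection on the span of two vectors *)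

Section projection.
Context {R : realType} (d : nat).
Implicit Types x y : 'I_d -> R.

Lemma dotfC x y : dotf x y = dotf y x.
Proof. by apply: eq_bigr => i _; rewrite mulrC. Qed.

Lemma dotf_lin x (a b : R) y z :
  dotf x (fun i => a * y i + b * z i) = a * dotf x y + b * dotf x z.
Proof. by rewrite /dotf !mulr_sumr -big_split; apply: eq_bigr => i _ /=; ring. Qed.

Lemma dotf_sqr x : dotf x x = \sum_i x i ^+ 2.
Proof. by apply: eq_bigr => i _; rewrite expr2. Qed.

Lemma dotf_eq0 x : dotf x x = 0 -> forall i, x i = 0.
Proof.
rewrite dotf_sqr => /eqP; rewrite psumr_eq0 => [/allP x0 i|i _]; last exact: sqr_ge0.
by have := x0 i (mem_index_enum i); rewrite /= sqrf_eq0 => /eqP.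
Qed.

(* [p j] is the orthogonal projection of the [j]-th basis vector on the span of
   [x] and [y]; the squared norms add up to its trace. *)
Lemma span2_projection x y : exists p : 'I_d -> 'I_d -> R,
  [/\ forall j, dotf x (p j) = x j, forall j, dotf y (p j) = y j &
    \sum_j \sum_i p j i ^+ 2 <= 2].
Proof.
(* Gram-Schmidt: [v] is [y] minus its component along [x]. As division by 0 gives 0, the same
   formulas cover the degenerate cases [x = 0] and [v = 0]. *)
pose c := dotf x y / dotf x x; pose v i := 1 * y i + - c * x i.
pose p j i := x j / dotf x x * x i + v j / dotf v v * v i.
have divK (z : 'I_d -> R) j : z j / dotf z z * dotf z z = z j.
  have [z0|z0] := eqVneq (dotf z z) 0; last by rewrite divfK.
  by rewrite (dotf_eq0 z0) !mul0r.
have xv : dotf x v = 0.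
  rewrite dotf_lin mul1r mulNr; have [x0|x0] := eqVneq (dotf x x) 0.
    by rewrite x0 mulr0 subr0 /dotf big1// => i _; rewrite (dotf_eq0 x0) mul0r.
  by rewrite divfK// subrr.
have vx : dotf v x = 0 by rewrite dotfC.
have yv : dotf y v = dotf v v.
  by rewrite [RHS]dotf_lin vx mulr0 addr0 mul1r dotfC.
have yx : dotf y x = c * dotf x x.
  rewrite dotfC /c; have [x0|x0] := eqVneq (dotf x x) 0; last by rewrite divfK.
  by rewrite x0 mulr0 /dotf big1// => i _; rewrite (dotf_eq0 x0) mul0r.
have plin z j : dotf (p j) z = x j / dotf x x * dotf z x + v j / dotf v v * dotf z v.
  by rewrite dotfC dotf_lin.
have px j : dotf (p j) x = x j by rewrite plin xv mulr0 addr0 divK.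
have pv j : dotf (p j) v = v j by rewrite plin vx mulr0 add0r divK.
exists p; split => [j|j|].
- by rewrite dotfC.
- by rewrite dotfC plin yx yv mulrCA !divK /v; ring.
have -> : \sum_j \sum_i p j i ^+ 2 =
    \sum_j (x j * (x j / dotf x x) + v j * (v j / dotf v v)).
  apply: eq_bigr => j _; rewrite -dotf_sqr plin px pv.
  by rewrite mulrC [X in _ + X]mulrC.
rewrite big_split/=.
(* Each of the two orthogonal directions contributes 1 to the trace, or 0 if its vector is zero. *)
have tr (z : 'I_d -> R) : \sum_j z j * (z j / dotf z z) <= 1.
  under eq_bigr do rewrite mulrA -expr2.
  rewrite -mulr_suml -dotf_sqr; have [->|z0] := eqVneq (dotf z z) 0.
    by rewrite mul0r.
  by rewrite divff.
by have := tr x; have := tr v; lra.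
Qed.

End projection.

(** * The game inside one block and the information bound *)

Lemma measurable_rcons d1 d2 (T1 : measurableType d1) (T2 : measurableType d2) n
    (f : T1 -> n.-tuple T2) (g : T1 -> T2) :
  measurable_fun setT f -> measurable_fun setT g ->
  measurable_fun setT (fun x => [tuple of rcons (f x) (g x)]).
Proof.
move=> mf mg; apply/measurable_fun_tnthP => /= i.
have [lt_in|le_ni] := ltnP i n.
  rewrite (_ : _ \o _ = fun x => tnth (f x) (Ordinal lt_in)).
    by move/measurable_fun_tnthP: mf => /(_ (Ordinal lt_in)).
  apply/funext => x /=; rewrite (tnth_nth (g x)) /= nth_rcons size_tuple lt_in.
  by rewrite (tnth_nth (g x)).
rewrite (_ : _ \o _ = g)//; apply/funext => x /=.
have ei : i = n :> nat by apply/eqP; rewrite eqn_leq le_ni -ltnS ltn_ord.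
by rewrite (tnth_nth (g x)) /= nth_rcons size_tuple ei ltnn eqxx.
Qed.

Definition linloss {R : realType} d (z x : 'rV[R]_d) : R := \sum_i z 0 i * x 0 i.

Section game.
Context {R : realType} (d : nat) (disp : measure_display)
  (Omega : measurableType disp) (A : bandit_algorithm R d Omega).
Context dE (E : measurableType dE) (nu : probability E R)
  (xi : 'I_d -> E -> R) (m : R).
Hypothesis xiP : is_noise nu xi m.
Variables (G delta : R).

(** The shift is subtracted because the slopes are losses: it makes coordinate [j] cheaper by
    [G / 2 * c]. *)
Definition noise_slope (j : 'I_d) (c : R) (e : E) : 'rV[R]_d :=
  \row_i (G / 2 * (xi i e - c * (i == j)%:R)).

Definition next_state t (wh : Omega * t.-tuple (R * R)) (z : 'rV[R]_d) :
    Omega * t.+1.-tuple (R * R) :=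
  (wh.1, [tuple of rcons wh.2 (linloss z (query_pos A wh), linloss z (query_neg A wh))]).

(** For a linear loss, the mean of the two observed values is the loss of this point. *)
Definition midpoint t (wh : Omega * t.-tuple (R * R)) : 'rV[R]_d :=
  2^-1 *: (query_pos A wh + query_neg A wh).

(* Expected number of rounds, among the last [k] of a block with hidden
   coordinate [j], lost by not playing [j]. The shift is by [2 * delta] with
   probability 1/2, not always by [delta]: this keeps the likelihood ratio
   against the unshifted noise above 1/2 although the shifted noise is not
   equivalent to the unshifted one. *)
Fixpoint block_value (j : 'I_d) (k : nat) : forall t, Omega * t.-tuple (R * R) -> R :=
  match k with
  | 0 => fun=> fun=> 0
  | k'.+1 => fun t wh => (1 - midpoint wh 0 j) +
      (\int[nu]_e block_value j k' (next_state wh (noise_slope j 0 e)) +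
       \int[nu]_e block_value j k' (next_state wh (noise_slope j (2 * delta) e))) / 2
  end.

Let mxi i : measurable_fun setT (xi i). Proof. by case: xiP. Qed.

Lemma measurable_slope j c i : measurable_fun setT (fun e => noise_slope j c e 0 i).
Proof.
rewrite (_ : (fun e => _) = fun e => G / 2 * (xi i e - c * (i == j)%:R)); last first.
  by apply/funext => e; rewrite mxE.
by apply: measurable_funM => //; exact: measurable_funB.
Qed.

Lemma measurable_linloss d1 (T : measurableType d1) (z x : T -> 'rV[R]_d) :
  (forall i, measurable_fun setT (fun y => z y 0 i)) ->
  (forall i, measurable_fun setT (fun y => x y 0 i)) ->
  measurable_fun setT (fun y => linloss (z y) (x y)).
Proof. by move=> mz mx; apply: measurable_sum => i; exact: measurable_funM. Qed.

Lemma measurable_next t j c :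
  measurable_fun setT (fun p : (Omega * t.-tuple (R * R)) * E =>
    next_state p.1 (noise_slope j c p.2)).
Proof.
apply/measurable_fun_pair => /=; first by apply: measurableT_comp.
apply: measurable_rcons => /=; first by apply: measurableT_comp.
apply/measurable_fun_pair => /=; apply: measurable_linloss => i.
- exact: (measurableT_comp (measurable_slope j c i)).
- exact: (measurableT_comp (measurable_query_pos A i)).
- exact: (measurableT_comp (measurable_slope j c i)).
- exact: (measurableT_comp (measurable_query_neg A i)).
Qed.

Lemma mid_simplex t (wh : Omega * t.-tuple (R * R)) : simplex (midpoint wh).
Proof.
have [p0 p1] := query_pos_simplex A wh; have [n0 n1] := query_neg_simplex A wh.
split=> [j|]; first by rewrite !mxE mulr_ge0 ?addr_ge0// invr_ge0.
under eq_bigr do rewrite !mxE.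
by rewrite -mulr_sumr big_split/= p1 n1; field.
Qed.

Lemma simplex_le1 (x : 'rV[R]_d) j : simplex x -> 0 <= x 0 j <= 1.
Proof.
move=> [x0 x1]; rewrite x0 -x1 (bigD1 j)//= lerDl.
by rewrite sumr_ge0.
Qed.

Lemma measurable_mid t j : measurable_fun setT (fun wh : Omega * t.-tuple (R * R) => midpoint wh 0 j).
Proof.
rewrite (_ : (fun wh => _) = fun wh => 2^-1 * (query_pos A wh 0 j + query_neg A wh 0 j)).
  apply: measurable_funM => //; apply: measurable_funD.
    exact: measurable_query_pos.
  exact: measurable_query_neg.
by apply/funext => wh; rewrite !mxE.
Qed.

Lemma block_value_spec j k t : measurable_fun setT (block_value j k (t := t)) /\
  forall wh : Omega * t.-tuple (R * R), 0 <= block_value j k wh <= k%:R.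
Proof.
elim: k t => [|k ih] t; first by split=> //= wh; rewrite lexx.
have [mv vk] := ih t.+1.
have mnext c : measurable_fun setT
    (fun p : (Omega * t.-tuple (R * R)) * E => block_value j k (next_state p.1 (noise_slope j c p.2))).
  by apply: measurableT_comp => //; exact: measurable_next.
have ik c (wh : Omega * t.-tuple (R * R)) :
    0 <= \int[nu]_e block_value j k (next_state wh (noise_slope j c e)) <= k%:R.
  apply: Rintegral_itv => // .
  exact: (measurableT_comp (mnext c) (pair1_measurable wh)).
split=> [|wh].
  apply: measurable_funD; first by apply: measurable_funB => //; exact: measurable_mid.
  have mI c : measurable_fun setT (fun wh : Omega * t.-tuple (R * R) =>
      \int[nu]_e block_value j k (next_state wh (noise_slope j c e))).
    apply: (measurable_Rintegral_snd nu (mnext c)) => p.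
    by have /andP[] := vk (next_state p.1 (noise_slope j c p.2)).
  by apply: measurable_funM => //; exact: measurable_funD.
have /andP[x0 x1] := simplex_le1 j (mid_simplex wh).
have /andP[i0 i1] := ik 0 wh; have /andP[j0 j1] := ik (2 * delta) wh.
by rewrite /= -[k.+1]addn1 natrD; lra.
Qed.

Lemma linloss_slope (x : 'rV[R]_d) j c e : linloss (noise_slope j c e) x =
  \sum_i G / 2 * x 0 i * xi i e - G / 2 * c * x 0 j.
Proof.
rewrite /linloss; under eq_bigr do rewrite mxE.
rewrite (_ : G / 2 * c * x 0 j = \sum_i G / 2 * c * (i == j)%:R * x 0 i).
  by rewrite -sumrB; apply: eq_bigr => i _; ring.
rewrite (bigD1 j)//= eqxx mulr1 big1 ?addr0// => i /negbTE ->.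
by rewrite mulr0 mul0r.
Qed.

(* Moving the noise by [- c * p] instead of [- c] times the [j]-th basis vector
   is invisible at the query points. *)
Lemma observation_shift (p : 'I_d -> R) (x : 'rV[R]_d) j c e :
  dotf (x 0) p = x 0 j ->
  linloss (noise_slope j c e) x =
    dotf (fun i => G / 2 * x 0 i) (fun i => xi i e + - c * p i).
Proof.
move=> xp; rewrite linloss_slope -xp /dotf mulr_sumr -sumrB.
by apply: eq_bigr => i _; ring.
Qed.

(* [w j] is the likelihood ratio of the past of the block under the hypothesis
   [j], against the noise without any shift, and [a j] is the past loss. A round
   multiplies [w j] by [(1 + u ^ 2) / 2], so that the potential [- ln (w j)] grows
   by at most three times the Hellinger loss on average. *)
Lemma sum_block_value_ge (N : R) k t (wh : Omega * t.-tuple (R * R)) (w a : 'I_d -> R) :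
  0 <= N -> (forall j, 0 < w j) -> (forall j, 0 <= a j) ->
  (forall j, a j + k%:R <= N) ->
  \sum_j (a j - N * (1 / 3 + 2 * (w j - 1 - ln (w j))))
    + k%:R * (d%:R - 1) - 240 * N * k%:R * delta ^+ 2
  <= \sum_j w j * (a j + block_value j k wh).
Proof.
move=> N0; elim: k t wh w a => [|k ih] t wh w a w0 a0 aN.
  rewrite !mul0r mulr0 mul0r subr0 addr0; apply: ler_sum => j _ /=.
  have l1 := onem_le_ln (w0 j); have l2 := ln_le_subr1 (w0 j).
  have := aN j; have := a0 j; have := w0 j; rewrite addr0.
  set D := 1 / 3 + 2 * (w j - 1 - ln (w j)) in l1 *.
  have D0 : 0 <= D by rewrite /D; lra.
  (* For [w j >= 1] the left side is at most 0; otherwise the factors are compared separately,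
     [a j <= N] and [1 - w j <= D]. *)
  move=> wj aj ajN; suff : a j * (1 - w j) <= N * D by lra.
  have [?|?] := leP (1 - w j) 0.
    apply: (@le_trans _ _ 0); first by rewrite mulr_ge0_le0.
    by rewrite mulr_ge0// (le_trans aj).
  by apply: ler_pM => //; exact: ltW.
have [p [xp yp p2]] := span2_projection (query_pos A wh 0) (query_neg A wh 0).
have [_ _ _ sh] := xiP.
(* The shift goes along the projection [p j], so its Hellinger cost is proportional to the squared
   norm of [p j]. *)
have /choice[u su] : forall j, exists u, noise_shift nu xi (fun i => - (2 * delta) * p j i) u.
  by move=> j; exact: sh.
pose h j (y : R * R) := block_value j k (wh.1, [tuple of rcons wh.2 y]).
have mh j : measurable_fun setT (h j).
  apply: measurableT_comp; first exact: (block_value_spec j k t.+1).1.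
  by apply/measurable_fun_pair => //=; exact: measurable_rcons.
have hk j y : 0 <= h j y <= k%:R by exact: (block_value_spec j k t.+1).2.
pose al i := G / 2 * query_pos A wh 0 i.
pose be i := G / 2 * query_neg A wh 0 i.
have nextE j c e : block_value j k (next_state wh (noise_slope j c e)) =
    h j (dotf al (fun i => xi i e + - c * p j i), dotf be (fun i => xi i e + - c * p j i)).
  by rewrite /h -(observation_shift _ _ (xp j)) -(observation_shift _ _ (yp j)).
pose V0 j e := h j (dotf al (xi ^~ e), dotf be (xi ^~ e)).
have V0E j e : block_value j k (next_state wh (noise_slope j 0 e)) = V0 j e.
  rewrite nextE /V0; congr (h j (_, _));
  by congr dotf; apply/funext => i; rewrite oppr0 mul0r addr0.
have IV0 j : nu.-integrable setT (EFin \o V0 j).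
  apply: (@bounded_integrable _ _ _ _ k%:R) => [|e].
    apply: measurableT_comp => //; apply/measurable_fun_pair => /=;
      by apply: measurable_sum => i; exact: measurable_funM.
  by have /andP[v0 v1] := hk j (dotf al (xi ^~ e), dotf be (xi ^~ e)); rewrite ger0_norm.
have Iu j := integrable_noise_ratio (su j).
have Iu2 j := integrable_noise_sqr (su j).
have IVu j : nu.-integrable setT (EFin \o (fun e => V0 j e * u j e ^+ 2)).
  exact: (integrable_noise_obs mxi (su j) al be (mh j) (hk j)).
have V1 j : \int[nu]_e (V0 j e * u j e ^+ 2) <=
    \int[nu]_e block_value j k (next_state wh (noise_slope j (2 * delta) e)).
  under [leRHS]eq_Rintegral do rewrite nextE.
  exact: (Rintegral_noise_obs mxi (su j) al be (mh j) (hk j)).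
pose l j := 1 - midpoint wh 0 j.
have mS := mid_simplex wh.
have l01 j : 0 <= l j <= 1 by have := simplex_le1 j mS; rewrite /l; lra.
(* The midpoint has total mass 1, so a round costs [d - 1] when summed over all hypotheses. *)
have suml : \sum_j l j = d%:R - 1.
  by rewrite sumrB (mS.2) sumr_const card_ord.
(* [U j e] is the [j]-th term of the potential after one round, with [ln_mid_sqr] applied to the new
   logarithm; [L j e] is the corresponding term on the right, where the weight is multiplied by
   [(1 + u j e ^+ 2) / 2]. *)
pose B j := a j + l j - N / 3 - 2 * N * (w j / 2 + 1 - ln (w j)).
pose U j e := B j + 6 * N * u j e + - (N * (w j + 2)) * u j e ^+ 2 + 0 * u j e.
pose L j e := w j / 2 * (a j + l j) + w j / 2 * (a j + l j) * u j e ^+ 2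
   + w j / 2 * V0 j e + w j / 2 * (V0 j e * u j e ^+ 2).
have [IU EU] : (forall j, nu.-integrable setT (EFin \o U j)) /\
    forall j, \int[nu]_e U j e = B j + 6 * N * \int[nu]_e u j e
       + - (N * (w j + 2)) * \int[nu]_e (u j e ^+ 2) + 0 * \int[nu]_e u j e.
  by split=> j; have [] := integrable_fun_lin3 (B j) (6 * N) (- (N * (w j + 2))) 0
    (Iu j) (Iu2 j) (Iu j).
have [IL EL] : (forall j, nu.-integrable setT (EFin \o L j)) /\
    forall j, \int[nu]_e L j e = w j / 2 * (a j + l j)
      + w j / 2 * (a j + l j) * \int[nu]_e (u j e ^+ 2)
      + w j / 2 * \int[nu]_e V0 j e + w j / 2 * \int[nu]_e (V0 j e * u j e ^+ 2).
  by split=> j; have [] := integrable_fun_lin3 (w j / 2 * (a j + l j))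
    (w j / 2 * (a j + l j)) (w j / 2) (w j / 2) (Iu2 j) (IV0 j) (IVu j).
pose C := k%:R * (d%:R - 1) - 240 * N * k%:R * delta ^+ 2.
(* The induction hypothesis for a fixed noise outcome, with the unshifted observation appended to
   the history and with updated weights and losses. *)
have UL e : C + \sum_j U j e <= \sum_j L j e.
  pose rho j := (1 + u j e ^+ 2) / 2.
  have rho0 j : 0 < rho j by rewrite divr_gt0// ltr_pwDl// sqr_ge0.
  pose wh' : Omega * t.+1.-tuple (R * R) :=
    (wh.1, [tuple of rcons wh.2 (dotf al (xi ^~ e), dotf be (xi ^~ e))]).
  have ih' := ih _ wh' (fun j => w j * rho j) (fun j => a j + l j).
  have -> : \sum_j L j e = \sum_j w j * rho j * (a j + l j + block_value j k wh').
    by apply: eq_bigr => j _; rewrite /L /rho -[block_value j k wh']/(V0 j e); ring.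
  rewrite addrC; apply: le_trans (ih' _ _ _) => [|j|j|j].
  - rewrite -addrA -/C lerD2r; apply: ler_sum => j _.
    have u0 : 0 <= u j e by case: (su j).
    have lr := ln_mid_sqr u0; rewrite -subr_ge0 in lr.
    have lE : ln (w j * rho j) = ln (w j) + ln (rho j) by rewrite lnM ?posrE.
    have := mulr_ge0 N0 lr; rewrite lE -/(rho j) /U /B.
    have -> : w j * rho j = w j / 2 + w j / 2 * u j e ^+ 2 by rewrite /rho; ring.
    by lra.
  - by rewrite mulr_gt0.
  - by have := l01 j; have := a0 j; lra.
  - by have := l01 j; have := aN j; rewrite -[k.+1]addn1 natrD; lra.
have IUL : C + \sum_j \int[nu]_e U j e <= \sum_j \int[nu]_e L j e.
  rewrite -!Rintegral_sum// -(Rintegral_probability_cst nu C).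
  have IC : nu.-integrable setT (EFin \o (fun=> C)).
    by apply: (@bounded_integrable _ _ _ _ `|C|).
  rewrite -RintegralD//; last exact: integrable_fun_sum.
  apply: le_Rintegral => //; last exact: integrable_fun_sum.
  by apply: integrable_funD => //; exact: integrable_fun_sum.
(* The mass bound on [u j ^+ 2] handles the losses so far, and [V1] replaces the reweighted
   continuation by the one under the shifted noise. *)
have Lj j : \int[nu]_e L j e <= w j * (a j + block_value j k.+1 wh).
  rewrite EL /= -/(l j).
  have s1 := Rintegral_noise_sqr (su j); have i1 := V1 j; have := w0 j => wj.
  have b0 : 0 <= a j + l j by have := l01 j; have := a0 j; lra.
  under [\int[nu]_e block_value j k (next_state wh (noise_slope j 0 e))]eq_Rintegral do rewrite V0E.
  have h1 : w j / 2 * (a j + l j) * \int[nu]_e (u j e ^+ 2) <= w j / 2 * (a j + l j) * 1.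
    by rewrite ler_wpM2l// mulr_ge0// divr_ge0// ltW.
  have h2 : w j / 2 * \int[nu]_e (V0 j e * u j e ^+ 2) <=
      w j / 2 * \int[nu]_e block_value j k (next_state wh (noise_slope j (2 * delta) e)).
    by rewrite ler_wpM2l// divr_ge0// ltW.
  by lra.
(* The factor 120 is 6 from the coefficient of [u j], times 5 from the affinity, times 4 from the
   square of [2 * delta]. The trace bound 2 then gives 240. *)
have Uj j : a j + l j - N * (1 / 3 + 2 * (w j - 1 - ln (w j)))
    - 120 * N * delta ^+ 2 * (\sum_i p j i ^+ 2) <= \int[nu]_e U j e.
  rewrite EU /B mul0r addr0.
  have s1 := Rintegral_noise_sqr (su j); have i1 := Rintegral_noise_ratio (su j).
  have pE : \sum_i (- (2 * delta) * p j i) ^+ 2 = 4 * delta ^+ 2 * \sum_i p j i ^+ 2.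
    by rewrite mulr_sumr; apply: eq_bigr => i _; ring.
  rewrite pE in i1; rewrite -subr_ge0 in s1; rewrite -subr_ge0 in i1.
  have wj : 0 <= w j + 2 by have := w0 j; lra.
  by have := mulr_ge0 N0 (mulr_ge0 wj s1); have := mulr_ge0 N0 i1; lra.
apply: le_trans (le_trans IUL (ler_sum _ (fun j _ => Lj j))).
apply: le_trans (lerD (lexx C) (ler_sum _ (fun j _ => Uj j))).
have -> : \sum_j (a j + l j - N * (1 / 3 + 2 * (w j - 1 - ln (w j))) -
      120 * N * delta ^+ 2 * \sum_i p j i ^+ 2) =
    \sum_j (a j - N * (1 / 3 + 2 * (w j - 1 - ln (w j)))) + (d%:R - 1)
      - 120 * N * delta ^+ 2 * \sum_j \sum_i p j i ^+ 2.
  by rewrite -suml mulr_sumr -big_split -sumrB; apply: eq_bigr => j _ /=; ring.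
have K0 : 0 <= 120 * N * delta ^+ 2 by apply: mulr_ge0; [exact: mulr_ge0|exact: sqr_ge0].
rewrite -subr_ge0 in p2; have := mulr_ge0 K0 p2.
by rewrite /C -[k.+1]addn1 natrD; lra.
Qed.

End game.

(** * Linear losses on the simplex *)

Section linear_losses.
Context {R : realType} (d : nat).
Implicit Types (z x y : 'rV[R]_d) (G : R).

Definition bounded_linear G (f : 'rV[R]_d -> R) :=
  exists z, (forall i, `|z 0 i| <= G) /\ f = linloss z.

Lemma linlossD z x y : linloss z (x + y) = linloss z x + linloss z y.
Proof. by rewrite /linloss -big_split; apply: eq_bigr => i _; rewrite mxE mulrDr. Qed.

Lemma linlossZ z (a : R) x : linloss z (a *: x) = a * linloss z x.
Proof. by rewrite /linloss mulr_sumr; apply: eq_bigr => i _; rewrite mxE mulrCA. Qed.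

Lemma linlossB z x y : linloss z (x - y) = linloss z x - linloss z y.
Proof. by rewrite linlossD -scaleN1r linlossZ mulN1r. Qed.

Lemma linloss_le z G x : (forall i, `|z 0 i| <= G) -> `|linloss z x| <= G * norm1 x.
Proof.
move=> zG; rewrite (le_trans (ler_norm_sum _ _ _))// mulr_sumr; apply: ler_sum => i _.
by rewrite normrM ler_wpM2r.
Qed.

Lemma linloss_delta z j : linloss z (delta_mx 0 j) = z 0 j.
Proof.
rewrite /linloss (bigD1 j)//= mxE !eqxx mulr1 big1 ?addr0// => i ij.
by rewrite mxE (negbTE ij) andbF mulr0.
Qed.

Lemma norm1_simplex x : simplex x -> norm1 x = 1.
Proof. by move=> [x0 <-]; apply: eq_bigr => j _; rewrite ger0_norm. Qed.

Lemma simplex_delta (j : 'I_d) : simplex (delta_mx 0 j : 'rV[R]_d).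
Proof.
split=> [i|]; first by rewrite mxE ler0n.
rewrite (bigD1 j)//= mxE !eqxx big1 ?addr0// => i ij.
by rewrite mxE (negbTE ij) andbF.
Qed.

Lemma linloss_simplex_le z G x : (forall i, `|z 0 i| <= G) -> simplex x ->
  `|linloss z x| <= G.
Proof. by move=> zG sx; rewrite (le_trans (linloss_le x zG))// norm1_simplex// mulr1. Qed.

Lemma bounded_linear_convex_lipschitz G f : bounded_linear G f -> convex_lipschitz G f.
Proof.
move=> [z [zG ->]]; split=> [t x y _ _|x y _ _].
  by rewrite /= /conv/= linlossD !linlossZ.
by rewrite -linlossB linloss_le.
Qed.

End linear_losses.

(** * Choosing the loss of one round deterministically *)

Section derandomization.
Context {R : realType} (d : nat) (disp : measure_display)
  (Omega : measurableType disp) (A : bandit_algorithm R d Omega)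
  (mu : probability Omega R).
Context dE (E : measurableType dE) (nu : probability E R)
  (xi : 'I_d -> E -> R) (m : R).
Hypothesis xiP : is_noise nu xi m.
Variables (G delta : R).
Hypotheses (G0 : 0 < G) (delta01 : 0 <= 2 * delta <= 1).

Local Notation slope := (noise_slope xi G).
Local Notation next := (next_state A).
Local Notation mid := (midpoint A).
Local Notation value := (block_value A nu xi G delta).
Implicit Types (f : nat -> 'rV[R]_d -> R).

Definition run_state f t w := (w, history A f w t).

Definition gap f (j : 'I_d) t w : R :=
  (f t (point_pos A f t w) + f t (point_neg A f t w)) / 2 - f t (delta_mx 0 j).

Lemma history_agree f f' t w : (forall s, (s < t)%N -> f s = f' s) ->
  history A f w t = history A f' w t.
Proof.
elim: t => [//|t ih] ff'; rewrite /= ih => [|s st]; last by rewrite ff'// ltnS ltnW.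
by rewrite ff'.
Qed.

Lemma measurable_state f t : (forall s, (s < t)%N -> bounded_linear G (f s)) ->
  measurable_fun setT (run_state f t).
Proof.
elim: t => [|t ih] fl.
  apply/measurable_fun_pair => /=; first exact: measurable_id.
  exact: measurable_cst.
have {}ih := ih (fun s st => fl s (ltnW st)).
have [z [_ fz]] := fl t (ltnSn t).
apply/measurable_fun_pair => /=; first exact: measurable_id.
apply: measurable_rcons; first by apply: (measurableT_comp measurable_snd ih).
rewrite fz; apply/measurable_fun_pair => /=; apply: measurable_linloss => // i.
- exact: (measurableT_comp (measurable_query_pos A i) ih).
- exact: (measurableT_comp (measurable_query_neg A i) ih).
Qed.

Lemma gapE f j t w z : f t = linloss z ->
  gap f j t w = linloss z (mid (run_state f t w)) - z 0 j.
Proof.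
move=> fz; rewrite /gap fz linloss_delta /midpoint linlossZ linlossD.
by rewrite mulrC.
Qed.

Lemma gap_bounded f j t w : bounded_linear G (f t) -> `|gap f j t w| <= 2 * G.
Proof.
move=> [z [zG fz]]; rewrite (gapE _ _ fz) (le_trans (ler_normB _ _))//.
have := zG j; have := linloss_simplex_le zG (mid_simplex A (run_state f t w)).
by lra.
Qed.

Lemma measurable_gap f j t : (forall s, (s <= t)%N -> bounded_linear G (f s)) ->
  measurable_fun setT (gap f j t).
Proof.
move=> fl; have [z [_ fz]] := fl t (leqnn t).
rewrite (_ : gap f j t = fun w => linloss z (mid (run_state f t w)) - z 0 j); last first.
  by apply/funext => w; rewrite (gapE _ _ fz).
apply: measurable_funB => //; apply: measurable_linloss => // i.
apply: (measurableT_comp (measurable_mid A i)).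
by apply: measurable_state => s st; exact: fl (ltnW st).
Qed.

Lemma integrable_gap f j t : (forall s, (s <= t)%N -> bounded_linear G (f s)) ->
  mu.-integrable setT (EFin \o gap f j t).
Proof.
move=> fl; apply: (@bounded_integrable _ _ _ _ (2 * G)); first exact: measurable_gap.
by move=> w; apply: gap_bounded; exact: fl.
Qed.

Lemma slope_bounded j c e i : 0 <= c <= 1 -> `|slope j c e 0 i| <= G.
Proof.
move=> /andP[c0 c1]; have [_ xi01 _ _] := xiP; have /andP[x0 x1] := xi01 i e.
rewrite mxE normrM ger0_norm ?divr_ge0 ?ltW//.
suff : `|xi i e - c * (i == j)%:R| <= 1 by move: G0; nra.
by rewrite ler_norml; case: (i == j); rewrite ?mulr1 ?mulr0; lra.
Qed.

Lemma Rintegral_slope j c x :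
  \int[nu]_e linloss (slope j c e) x =
  G / 2 * (m * (\sum_i x 0 i) - c * x 0 j).
Proof.
have [mxi xi01 Exi _] := xiP.
have Ixi i : nu.-integrable setT (EFin \o xi i).
  apply: (@bounded_integrable _ _ _ _ 1) => // e.
  by have /andP[x0 x1] := xi01 i e; rewrite ger0_norm.
have Exi' i : \int[nu]_e xi i e = m by rewrite /Rintegral Exi.
transitivity (\int[nu]_e (- (G / 2 * c * x 0 j) +
    \sum_i G / 2 * x 0 i * xi i e)).
  by apply: eq_Rintegral => e _; rewrite linloss_slope addrC.
rewrite RintegralD//; last 2 first.
- by apply: (@bounded_integrable _ _ _ _ `|- (G / 2 * c * x 0 j)|).
- by apply: integrable_fun_sum => i; exact: integrable_funZ.
rewrite Rintegral_probability_cst Rintegral_sum; last by move=> i; exact: integrable_funZ.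
under eq_bigr do rewrite RintegralZl// Exi'.
rewrite mulrBr mulrA mulr_sumr addrC; congr (_ + _); last by ring.
by apply: eq_bigr => i _; ring.
Qed.

(** The common mean cancels because the coordinates of [x] and of the vertex both sum to 1. *)
Lemma Rintegral_slope_gap j c x : simplex x ->
  \int[nu]_e linloss (slope j c e) (x - delta_mx 0 j) = G / 2 * c * (1 - x 0 j).
Proof.
move=> [_ x1]; rewrite Rintegral_slope.
have -> : \sum_i (x - delta_mx 0 j) 0 i = 0.
  under eq_bigr do rewrite !mxE.
  by rewrite sumrB x1; have [_] := simplex_delta (R := R) j; 
    under eq_bigr do rewrite mxE; move=> ->; rewrite subrr.
by rewrite !mxE !eqxx /=; ring.
Qed.

(** The recursion for [block_value], scaled by [G / 2 * delta], is an average over the noise and the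
    two shifts of the current gap plus the scaled continuation. By Fubini this average can be taken
    after the one over the algorithm's randomness, so some slope does at least as well. *)
Lemma mean_gap_step j k f t : (forall s, (s < t)%N -> bounded_linear G (f s)) ->
  exists z : 'rV[R]_d, (forall i, `|z 0 i| <= G) /\
    G / 2 * delta * \int[mu]_w value j k.+1 (run_state f t w) <=
    \int[mu]_w (linloss z (mid (run_state f t w)) - z 0 j) +
    G / 2 * delta * \int[mu]_w value j k (next (run_state f t w) z).
Proof.
move=> fl; have mst := measurable_state fl.
have vP := block_value_spec A xiP G delta j k t.+1.
pose Phi c (p : Omega * E) : R := linloss (slope j c p.2) (mid (run_state f t p.1)) -
  slope j c p.2 0 j + G / 2 * delta * value j k (next (run_state f t p.1) (slope j c p.2)).
have mval c : measurable_fun setT (fun p : Omega * E =>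
    value j k (next (run_state f t p.1) (slope j c p.2))).
  apply: (measurableT_comp (f := value j k (t := t.+1))); first exact: vP.1.
  have mpair : measurable_fun setT (fun p : Omega * E => (run_state f t p.1, p.2)).
    by apply/measurable_fun_pair => //=; exact: (measurableT_comp mst).
  exact: (measurableT_comp (measurable_next A xiP G j c) mpair).
have msl c i : measurable_fun setT (fun p : Omega * E => slope j c p.2 0 i).
  exact: (measurableT_comp (measurable_slope xiP G j c i)).
have mlin c : measurable_fun setT (fun p : Omega * E =>
    linloss (slope j c p.2) (mid (run_state f t p.1)) - slope j c p.2 0 j).
  apply: measurable_funB => //; apply: measurable_linloss => // i.
  by apply: (measurableT_comp (measurable_mid A i)); exact: (measurableT_comp mst).
have mPhi c : measurable_fun setT (Phi c).
  by apply: measurable_funD => //; exact: measurable_funM.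
have delta0 : 0 <= delta by have /andP[] := delta01; lra.
have delta1 : delta <= 1 by have /andP[] := delta01; lra.
have val_le c w e : 0 <= G / 2 * delta * value j k (next (run_state f t w) (slope j c e)) <= G * k%:R.
  have /andP[v0 v1] := vP.2 (next (run_state f t w) (slope j c e)).
  have g0 : 0 <= G / 2 * delta by rewrite mulr_ge0// divr_ge0// ltW.
  rewrite mulr_ge0//=; apply: ler_pM => //.
  by move: G0; nra.
have lin_le c w e : 0 <= c <= 1 ->
    `|linloss (slope j c e) (mid (run_state f t w)) - slope j c e 0 j| <= 2 * G.
  move=> c01; have sG i := slope_bounded j e i c01.
  rewrite (le_trans (ler_normB _ _))//.
  by have := sG j; have := linloss_simplex_le sG (mid_simplex A (run_state f t w)); lra.
pose B : R := 2 * G + G * k%:R.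
have PhiB c : 0 <= c <= 1 -> forall p, `|Phi c p| <= B.
  move=> c01 [w e]; rewrite (le_trans (ler_normD _ _))// lerD//=; first exact: lin_le.
  by have /andP[v0 v1] := val_le c w e; rewrite ger0_norm.
have c0 : 0 <= (0 : R) <= 1 by rewrite lexx ler01.
pose F (p : Omega * E) := (Phi 0 p + Phi (2 * delta) p) / 2.
have mF : measurable_fun setT F by apply: measurable_funM => //; exact: measurable_funD.
have FB p : `|F p| <= B.
  have := PhiB _ c0 p; have := PhiB _ delta01 p.
  by rewrite !ler_norml /F; lra.
have IE (g : E -> R) (b : R) : measurable_fun setT g -> (forall e, `|g e| <= b) ->
    nu.-integrable setT (EFin \o g) by move=> mg gb; exact: (@bounded_integrable _ _ _ _ b).
have IW (g : Omega -> R) (b : R) : measurable_fun setT g -> (forall e, `|g e| <= b) ->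
    mu.-integrable setT (EFin \o g) by move=> mg gb; exact: (@bounded_integrable _ _ _ _ b).
(* The mean gap is 0 without shift and [G * delta * (1 - x 0 j)] with shift [2 * delta]; half their
   sum is the scaled first term of the recursion. *)
have inner w : \int[nu]_e F (w, e) = G / 2 * delta * value j k.+1 (run_state f t w).
  have x1 := mid_simplex A (run_state f t w); set x := mid (run_state f t w) in x1 *.
  have I1 c : 0 <= c <= 1 -> nu.-integrable setT
      (EFin \o (fun e => linloss (slope j c e) x - slope j c e 0 j)).
    move=> c01; apply: (IE _ (2 * G)) => [|e]; last exact: lin_le.
    exact: (measurableT_comp (mlin c) (pair1_measurable w)).
  have I2 c : nu.-integrable setT
      (EFin \o (fun e => G / 2 * delta * value j k (next (run_state f t w) (slope j c e)))).
    apply: (IE _ (G * k%:R)) => [|e].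
      by apply: measurable_funM => //; exact: (measurableT_comp (mval c) (pair1_measurable w)).
    by have /andP[v0 v1] := val_le c w e; rewrite ger0_norm.
  have I3 c : nu.-integrable setT
      (EFin \o (fun e => value j k (next (run_state f t w) (slope j c e)))).
    apply: (IE _ k%:R) => [|e].
      exact: (measurableT_comp (mval c) (pair1_measurable w)).
    by have /andP[v0 v1] := vP.2 (next (run_state f t w) (slope j c e)); rewrite ger0_norm.
  have IPhi c : 0 <= c <= 1 -> nu.-integrable setT (EFin \o (fun e => Phi c (w, e))).
    by move=> c01; apply: integrable_funD => //; exact: I1.
  have EPhi c : 0 <= c <= 1 -> \int[nu]_e Phi c (w, e) = G / 2 * c * (1 - x 0 j) +
      G / 2 * delta * \int[nu]_e value j k (next (run_state f t w) (slope j c e)).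
    move=> c01; rewrite /Phi /= RintegralD//; last exact: I1.
    rewrite RintegralZl//; congr (_ + _).
    transitivity (\int[nu]_e linloss (slope j c e) (x - delta_mx 0 j)).
      by apply: eq_Rintegral => e _; rewrite linlossB linloss_delta.
    exact: Rintegral_slope_gap.
  rewrite /F RintegralZr//; last by apply: integrable_funD => //; exact: IPhi.
  rewrite RintegralD//; [|exact: IPhi|exact: IPhi].
  by rewrite !EPhi//= -/x; lra.
have : \int[mu]_w \int[nu]_e F (w, e) <= \int[nu]_e \int[mu]_w F (w, e).
  by rewrite (Rintegral_swap mu nu mF FB).
under [X in X <= _]eq_Rintegral do rewrite inner.
move=> /(Rintegral_le_witness (integrable_Rintegral_fst mu nu mF FB))[e Fe].
have meas (h : Omega * E -> R) : measurable_fun setT h ->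
    measurable_fun setT (fun w => h (w, e)).
  by move=> mh; exact: (measurableT_comp mh (pair2_measurable e)).
have IPhi c : 0 <= c <= 1 -> mu.-integrable setT (EFin \o (fun w => Phi c (w, e))).
  move=> c01; apply: (IW _ B) => [|w]; last exact: PhiB.
  exact: (meas _ (mPhi c)).
have Ival : mu.-integrable setT (EFin \o (fun w => value j k.+1 (run_state f t w))).
  have [mv vk] := block_value_spec A xiP G delta j k.+1 t.
  apply: (IW _ k.+1%:R) => [|w]; first exact: (measurableT_comp mv mst).
  by have /andP[v0 v1] := vk (run_state f t w); rewrite ger0_norm.
rewrite RintegralZl// /F RintegralZr// in Fe; last first.
  by apply: integrable_funD => //; exact: IPhi.
rewrite RintegralD// in Fe; [|exact: IPhi|exact: IPhi].
(* One of the two shifts reaches the average of both. *)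
have [c c01 Fc] : exists2 c, 0 <= c <= 1 & G / 2 * delta *
    \int[mu]_w value j k.+1 (run_state f t w) <= \int[mu]_w Phi c (w, e).
  have [h|h] := leP (G / 2 * delta * \int[mu]_w value j k.+1 (run_state f t w))
    (\int[mu]_w Phi 0 (w, e)); first by exists 0.
  by exists (2 * delta) => //; lra.
exists (slope j c e); split; first by move=> i; exact: slope_bounded.
apply: le_trans Fc _; rewrite /Phi /= RintegralD//.
- rewrite RintegralZl//; apply: (IW _ k%:R) => [|w]; first exact: (meas _ (mval c)).
  by have /andP[v0 v1] := vP.2 (next (run_state f t w) (slope j c e)); rewrite ger0_norm.
- by apply: (IW _ (2 * G)) => [|w]; [exact: (meas _ (mlin c))|exact: lin_le].
- apply: (IW _ (G * k%:R)) => [|w].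
    by apply: measurable_funM => //; exact: (meas _ (mval c)).
  by have /andP[v0 v1] := val_le c w e; rewrite ger0_norm.
Qed.

End derandomization.

(** * Losses for a block and for a sequence of blocks *)

Section blocks.
Context {R : realType} (d : nat) (disp : measure_display)
  (Omega : measurableType disp) (A : bandit_algorithm R d Omega)
  (mu : probability Omega R).
Context dE (E : measurableType dE) (nu : probability E R)
  (xi : 'I_d -> E -> R) (m : R).
Hypothesis xiP : is_noise nu xi m.
Variables (G delta : R).
Hypotheses (G0 : 0 < G) (delta01 : 0 <= 2 * delta <= 1).

Local Notation value := (block_value A nu xi G delta).
Local Notation state := (run_state A).
Local Notation gap := (gap A).
Implicit Types (f : nat -> 'rV[R]_d -> R).

Lemma gap_agree f f' j t w : (forall s, (s <= t)%N -> f s = f' s) ->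
  gap f j t w = gap f' j t w.
Proof.
move=> ff'; rewrite /gap /point_pos /point_neg ff'//.
by rewrite (@history_agree _ _ _ _ A f f' t w) // => s st; exact: ff' (ltnW st).
Qed.

(** One slope is fixed per round, and the later ones are chosen given it. The gaps already counted
    do not change, since a gap depends only on the losses up to its round. *)
Lemma gap_ge_val j k t f : (forall s, (s < t)%N -> bounded_linear G (f s)) ->
  exists f', [/\ forall s, (s < t)%N -> f' s = f s,
    forall s, (s < t + k)%N -> bounded_linear G (f' s) &
    G / 2 * delta * \int[mu]_w value j k (state f t w) <=
      \sum_(t <= s < t + k) \int[mu]_w gap f' j s w].
Proof.
elim: k t f => [|k ih] t f fl.
  exists f; split=> //; first by rewrite addn0.
  by rewrite addn0 big_geq//= Rintegral_probability_cst mulr0.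
have [z [zG le_z]] := mean_gap_step A mu xiP G0 delta01 j k fl.
pose f1 s := if s == t then linloss z else f s.
have f1t : f1 t = linloss z by rewrite /f1 eqxx.
have f1f s : (s < t)%N -> f1 s = f s by rewrite /f1 => /ltn_eqF ->.
have f1l s : (s < t.+1)%N -> bounded_linear G (f1 s).
  rewrite ltnS leq_eqVlt => /predU1P[->|st]; last by rewrite f1f//; exact: fl.
  by rewrite f1t; exists z.
have [f' [f'f1 f'l le_f']] := ih t.+1 f1 f1l.
have st w : state f1 t w = state f t w.
  by rewrite /run_state (@history_agree _ _ _ _ A f1 f t w).
exists f'; split=> [s ts|s|].
- by rewrite f'f1 ?f1f// ltnS ltnW.
- by rewrite -addSnnS; exact: f'l.
rewrite big_ltn; last by rewrite addnS ltnS leq_addr.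
apply: le_trans le_z _; rewrite addnS -addSn; apply: lerD.
  rewrite le_eqVlt; apply/orP; left; apply/eqP; apply: eq_Rintegral => w _.
  rewrite (@gap_agree f' f1) => [|s ss]; last exact: f'f1.
  by rewrite (gapE A _ _ f1t) st.
apply: le_trans le_f'; rewrite le_eqVlt; apply/orP; left; apply/eqP.
congr (_ * _); apply: eq_Rintegral => w _.
by rewrite -st /run_state /next_state /= f1t.
Qed.

(** Summed over the hypotheses, the values are at least [n * d * (2 / 3 - 1 / 10) - n], which is at
    least [2 / 5 * n * d] for [d >= 7]. Hence some coordinate has value at least [2 / 5 * n], to be
    scaled by [G / 2 * delta]. *)
Lemma block_gap n t f : (7 <= d)%N -> 240 * n%:R * delta ^+ 2 <= d%:R / 10 ->
  (forall s, (s < t)%N -> bounded_linear G (f s)) ->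
  exists f' j, [/\ forall s, (s < t)%N -> f' s = f s,
    forall s, (s < t + n)%N -> bounded_linear G (f' s) &
    G * delta * n%:R / 5 <= \sum_(t <= s < t + n) \int[mu]_w gap f' j s w].
Proof.
move=> d7 nd fl.
have delta0 : 0 <= delta by have /andP[] := delta01; lra.
have d7R : 7 <= d%:R :> R by rewrite (ler_nat R 7).
have n0 : 0 <= n%:R :> R by [].
have mst := measurable_state A fl.
have Ival j : mu.-integrable setT (EFin \o (fun w => value j n (state f t w))).
  have [mv vn] := block_value_spec A xiP G delta j n t.
  apply: (@bounded_integrable _ _ _ _ n%:R) => [|w]; first exact: (measurableT_comp mv mst).
  by have /andP[v0 v1] := vn (state f t w); rewrite ger0_norm.
have sum_val : 2 / 5 * n%:R * d%:R <= \sum_j \int[mu]_w value j n (state f t w).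
  rewrite -Rintegral_sum// -[leLHS](Rintegral_probability_cst mu).
  apply: le_Rintegral => //.
  - by apply: (@bounded_integrable _ _ _ _ `|2 / 5 * n%:R * d%:R|).
  - exact: integrable_fun_sum.
  move=> w _.
  (* At the start of the block all weights are 1 and all losses 0, so each potential term is
     [n / 3]. *)
  have := @sum_block_value_ge _ _ _ _ A _ _ _ _ _ xiP G delta n%:R n t (state f t w)
    (fun=> 1) (fun=> 0) n0 (fun=> ltr01) (fun=> lexx 0).
  rewrite add0r => /(_ (fun=> lexx _)).
  rewrite ln1 sumr_const card_ord.
  under [X in _ <= X -> _]eq_bigr do rewrite mul1r add0r.
  apply: le_trans; rewrite -mulr_natr.
  rewrite -subr_ge0 in nd; have h1 := mulr_ge0 n0 nd.
  have h2 : 0 <= n%:R * (d%:R - 7) :> R by rewrite mulr_ge0// subr_ge0.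
  lra.
have [j vj] : exists j, 2 / 5 * n%:R <= \int[mu]_w value j n (state f t w).
  apply: contrapT => /forallNP vj.
  have d0 : (0 < d)%N by apply: leq_trans d7.
  suff : \sum_j \int[mu]_w value j n (state f t w) < \sum_(j < d) 2 / 5 * n%:R.
    by rewrite sumr_const card_ord -[X in _ < X]mulr_natr ltNge sum_val.
  apply: ltr_sum; last by move=> j _; rewrite ltNge; exact/negP/vj.
  by apply/hasP; exists (Ordinal d0); rewrite ?mem_index_enum.
have [f' [f'f f'l le_f']] := gap_ge_val j n fl.
exists f', j; split=> //; apply: le_trans le_f'.
have g0 : 0 <= G / 2 * delta by rewrite mulr_ge0// divr_ge0// ltW.
rewrite -subr_ge0 in vj; have := mulr_ge0 g0 vj; lra.
Qed.

(** The hidden coordinate of a new block is chosen given the losses of all earlier blocks, whose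
    gaps it leaves unchanged. *)
Lemma blocks_gap n b : (7 <= d)%N -> 240 * n%:R * delta ^+ 2 <= d%:R / 10 ->
  exists f (J : nat -> 'I_d),
    (forall s, (s < b * n)%N -> bounded_linear G (f s)) /\
    G * delta * n%:R * b%:R / 5 <=
      \sum_(0 <= s < b * n) \int[mu]_w gap f (J (s %/ n)%N) s w.
Proof.
move=> d7 nd; have d0 : (0 < d)%N by apply: leq_trans d7.
elim: b => [|b [f [J [fl le_f]]]].
  exists (fun=> fun=> 0), (fun=> Ordinal d0); split=> //.
  by rewrite big_geq// mulr0 mul0r.
have [f' [j [f'f f'l le_f']]] := block_gap d7 nd fl.
exists f', (fun i => if i == b then j else J i).
rewrite mulSn addnC; split=> //.
rewrite (@big_cat_nat _ _ _ (b * n)%N)//= ?leq_addr//.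
rewrite -natr1 mulrDr mulr1 mulrDl; apply: lerD.
  apply: le_trans le_f _; rewrite le_eqVlt; apply/orP; left; apply/eqP.
  apply: eq_big_nat => s /andP[_ sb].
  have n0 : (0 < n)%N by case: (n) sb => //; rewrite muln0.
  rewrite ltn_eqF ?ltn_divLR//; apply: eq_Rintegral => w _.
  by apply: gap_agree => r rs; rewrite f'f// (leq_ltn_trans rs).
apply: le_trans le_f' _; rewrite le_eqVlt; apply/orP; left; apply/eqP.
apply: eq_big_nat => s /andP[bs sb].
suff -> : (s %/ n)%N = b by rewrite eqxx.
have n0 : (0 < n)%N by rewrite lt0n; apply/eqP => n0; move: sb; rewrite n0 muln0.
by apply/eqP; rewrite eqn_leq -ltnS ltn_divLR// leq_divRL// bs mulSn addnC sb.
Qed.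

End blocks.

(** * From gaps to expected regret *)

Lemma linloss0 {R : realType} d (x : 'rV[R]_d) : linloss 0 x = 0.
Proof. by rewrite /linloss big1// => i _; rewrite mxE mul0r. Qed.

Lemma bounded_linear0 {R : realType} d (G : R) : 0 <= G ->
  bounded_linear G (linloss (0 : 'rV[R]_d)).
Proof. by move=> G0; exists 0; split=> // i; rewrite mxE normr0. Qed.

Section expected_regret.
Context {R : realType} (d : nat) (disp : measure_display)
  (Omega : measurableType disp) (A : bandit_algorithm R d Omega)
  (mu : probability Omega R) (G P : R) (T : nat).
Variables (f : nat -> 'rV[R]_d -> R) (I : nat -> 'I_d).
Hypotheses (G0 : 0 <= G) (fl : forall t, bounded_linear G (f t)).
Hypothesis I_path : comparators T P (fun t => delta_mx 0 (I t)).

Lemma regret_ge_gap w : \sum_(t < T) gap A f (I t) t w <= regret A f T P w.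
Proof.
rewrite /gap sumrB lerD2l lerN2; apply: ge_inf; last first.
  by exists (fun t => delta_mx 0 (I t)).
(* The infimum is below the cost of the path [I] only if the set of costs is bounded below; each
   loss is at least [- G] on the simplex. *)
exists (- \sum_(t < T) G) => _ [u [su _] <-]; rewrite -sumrN.
apply: ler_sum => t _; have [z [zG ->]] := fl t.
by have := linloss_simplex_le zG (su t (ltn_ord t)); rewrite ler_norml => /andP[].
Qed.

Lemma expected_regret_ge_gap :
  ((\sum_(t < T) \int[mu]_w gap A f (I t) t w)%:E <= 'E_mu[regret A f T P])%E.
Proof.
have flt t s (_ : (s <= t)%N) := fl s.
have Igap t : mu.-integrable setT (EFin \o gap A f (I t) t).
  exact: integrable_gap (flt t).
have -> : ('E_mu[regret A f T P] = \int[mu]_w (regret A f T P w)%:E)%E by rewrite unlock.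
rewrite -Rintegral_sum//.
rewrite /Rintegral fineK; last exact/integrable_fin_num/integrable_fun_sum.
apply: le_integral => //; first exact: integrable_fun_sum.
  (* The regret differs from the sum of the gaps by a constant, hence is integrable. *)
  apply: (eq_integrable measurableT (EFin \o (fun w => \sum_(t < T) gap A f (I t) t w +
    (\sum_(t < T) f t (delta_mx 0 (I t)) -
      inf [set \sum_(t < T) f t (u t) | u in @comparators R d T P])))).
    by move=> w _ /=; rewrite /regret /gap sumrB; congr EFin; ring.
  apply: integrable_funD => //; first exact: integrable_fun_sum.
  by apply: (@bounded_integrable _ _ _ _ `|_|).
by move=> w _; rewrite lee_fin regret_ge_gap.
Qed.

End expected_regret.

(** * Path length of the comparators and the resulting rate *)

(** The path moves only when the block index increases, at a cost of at most 2; the index is capped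
    at [S], so it also stays put during the leftover rounds, and the increments telescope to at most
    [S]. *)
Lemma block_comparators {R : realType} d (P : R) (T n S : nat) (J : nat -> 'I_d) :
  2 * S%:R <= P -> (0 < n)%N ->
  comparators T P (fun t => delta_mx 0 (J (minn (t %/ n) S)) : 'rV[R]_d).
Proof.
move=> SP n0; split=> [t _|]; first exact: simplex_delta.
pose i t := minn (t %/ n) S.
have i_mono t : (i t <= i t.+1)%N.
  by rewrite leq_min geq_minr andbT geq_min leq_div2r.
apply: le_trans SP.
apply: (@le_trans _ _ (\sum_(t < T.-1) 2 * ((i t.+1)%:R - (i t)%:R))).
  apply: ler_sum => t _; have [ii|ii] := eqVneq (i t) (i t.+1).
    rewrite -/(i t) -/(i t.+1) -ii !subrr mulr0 /norm1 big1// => j _.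
    by rewrite !mxE normr0.
  have i_lt : (i t)%:R + 1 <= (i t.+1)%:R :> R by rewrite natr1 ler_nat ltn_neqAle ii i_mono.
  apply: (@le_trans _ _ 2); last by lra.
  apply: (@le_trans _ _ (norm1 (delta_mx 0 (J (i t.+1)) : 'rV[R]_d) +
      norm1 (delta_mx 0 (J (i t)) : 'rV[R]_d))).
    rewrite /norm1 -big_split; apply: ler_sum => j _.
    by rewrite !mxE ler_normB.
  by rewrite !norm1_simplex; [lra|exact: simplex_delta|exact: simplex_delta].
rewrite -mulr_sumr ler_pM2l//.
rewrite -(big_mkord xpredT (fun t => (i t.+1)%:R - (i t)%:R)) telescope_sumr//.
by rewrite (le_trans (_ : _ <= (i T.-1)%:R)) ?gerBl// ler_nat geq_minr.
Qed.

(** After squaring, [T * (1 + P) <= 6 * n * S ^+ 2] is compared with [196 / 25 * L * n * S ^+ 2],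
    and 196 / 25 times 6 / 7 exceeds 6. The factor 14 / 5 is 700 / 250. *)
Lemma rate_bound {R : realType} (D T P S n L : R) :
  0 < D -> 0 < n -> 0 < S -> 0 <= P -> 0 <= T -> T <= 2 * (n * S) -> 1 + P <= 3 * S ->
  6 / 7 <= L ->
  700^-1 * Num.sqrt (D * T * (1 + P) / L) <= 50^-1 * Num.sqrt (D / n) * n * S / 5.
Proof.
move=> D0 n0 S0 P0 T0 TnS PS L67; have L0 : 0 < L by lra.
set r := Num.sqrt (D / n).
have r2 : r ^+ 2 * n = D by rewrite sqr_sqrtr ?divfK ?gt_eqF// divr_ge0 ?ltW.
have r0 : 0 <= r by exact: sqrtr_ge0.
suff : Num.sqrt (D * T * (1 + P) / L) <= 14 / 5 * (r * n * S) by lra.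
have q0 : 0 <= 14 / 5 * (r * n * S) by rewrite !mulr_ge0// ltW.
rewrite -(ger0_norm q0) -sqrtr_sqr; apply: ler_wsqrtr.
rewrite ler_pdivrMr//.
have -> : (14 / 5 * (r * n * S)) ^+ 2 * L = 196 / 25 * (r ^+ 2 * n) * (n * S * S) * L by field.
rewrite r2.
have h1 : T * (1 + P) <= 2 * (n * S) * (3 * S) by apply: ler_pM => //; lra.
have h2 : 0 <= n * S * S by rewrite !mulr_ge0// ltW.
have h3 : T * (1 + P) <= 196 / 25 * (n * S * S) * L by nra.
by rewrite -mulrA; have := ler_wpM2l (ltW D0) h3; lra.
Qed.

(** * Choice of the parameters and the lower bound *)

Theorem theorem4p2 (R : realType) :
  exists c : R, 0 < c /\
    forall (d : nat) (G : R) (T : nat) (P : R),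
      (7 <= d)%N -> 0 < G -> (1 <= T)%N ->
      0 <= P -> P <= T%:R / (8 * d%:R) - 1 ->
      ((c * G * Num.sqrt (d%:R * T%:R * (1 + P) / ln d%:R))%:E
         <= minimax_regret d G T P)%E.
Proof.
exists 700^-1; split=> [|d G T P d7 G0 T1 P0 PT]; first by lra.
(* With [S] blocks there are at most [S - 1] switches, each of length at most 2, which fit in
   [P]. *)
pose S := (Num.trunc (P / 2)).+1; pose n := (T %/ S)%N.
have /andP[S1 S2] : (S.-1)%:R <= P / 2 < S%:R by apply: truncn_itv; rewrite divr_ge0.
have d7R : 7 <= d%:R :> R by rewrite (ler_nat R 7).
have SE : S%:R = (S.-1)%:R + 1 :> R by rewrite natr1.
(* As [S <= 1 + P], the upper bound on [P] makes every block at least [8 * d] rounds long. *)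
have SdT : (S * (8 * d) <= T)%N.
  rewrite -(ler_nat R) !natrM.
  have d8 : 0 < 8 * d%:R :> R by lra.
  have : (1 + P) * (8 * d%:R) <= T%:R by rewrite -ler_pdivlMr//; lra.
  by apply: le_trans; rewrite ler_pM2r//; lra.
have dn : (8 * d <= n)%N by rewrite leq_divRL// mulnC.
have n8 : 8 * d%:R <= n%:R :> R by rewrite -natrM ler_nat.
have n0 : (0 < n)%N by rewrite -(ltr_nat R); lra.
have TnS : T%:R <= 2 * (n%:R * S%:R) :> R.
  have : (T <= 2 * (n * S))%N.
    rewrite {1}(divn_eq T S) mul2n -addnn leq_add2l.
    by rewrite (leq_trans (ltnW (ltn_pmod T (ltn0Sn _))))// leq_pmull.
  by rewrite -(ler_nat R) !natrM.
(* The factor 1 / 50 gives [240 * n * delta ^+ 2 = 240 / 2500 * d], just below [d / 10]; with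
   [n >= 8 * d] it also gives [2 * delta <= 1]. *)
pose delta : R := 50^-1 * Num.sqrt (d%:R / n%:R).
have dn0 : 0 <= d%:R / n%:R :> R by rewrite divr_ge0.
have delta0 : 0 <= delta by rewrite mulr_ge0 ?invr_ge0// sqrtr_ge0.
have delta2 : delta ^+ 2 = 2500^-1 * (d%:R / n%:R).
  by rewrite exprMn sqr_sqrtr//; congr (_ * _); field.
have dn1 : d%:R / n%:R <= 1 / 8 :> R by rewrite ler_pdivrMr ?ltr0n//; lra.
have delta1 : 0 <= 2 * delta <= 1.
  by rewrite mulr_ge0//=; nra.
have nd : 240 * n%:R * delta ^+ 2 <= d%:R / 10.
  rewrite delta2 (_ : _ * _ * _ = 240 / 2500 * d%:R); first by lra.
  by field; rewrite pnatr_eq0 -lt0n.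
apply: le_ereal_inf_tmp => _ [disp [W [mu [A ->]]]].
have [m noise] := @is_noise_exists R.
have [dE [E [nu [xi xiP]]]] := noise d.
have [f0 [J [f0l le_f0]]] := blocks_gap A mu xiP G0 delta1 S d7 nd.
(* The [T %% S] rounds left over after the last block get zero loss, hence zero gap. *)
pose f t := if (t < S * n)%N then f0 t else linloss 0.
have fl t : bounded_linear G (f t).
  by rewrite /f; case: ifPn => [/f0l //|_]; exact/bounded_linear0/ltW.
pose I t := J (minn (t %/ n) S.-1).
have I_path : comparators T P (fun t => delta_mx 0 (I t) : 'rV[R]_d).
  by apply: block_comparators => //; lra.
apply: le_ereal_sup_tmp; exists 'E_mu[regret A f T P]%E.
  by exists f => // t _; exact: bounded_linear_convex_lipschitz.
apply: (@le_trans _ _ (\sum_(t < T) \int[mu]_w gap A f (I t) t w)%:E); last first.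
  exact: (expected_regret_ge_gap A mu fl I_path).
rewrite lee_fin -(big_mkord xpredT (fun t => \int[mu]_w gap A f (I t) t w)).
rewrite (@big_cat_nat _ _ _ (S * n)%N)//=; last by rewrite mulnC leq_trunc_div.
have -> : \sum_(S * n <= t < T) \int[mu]_w gap A f (I t) t w = 0.
  rewrite big_nat_cond big1// => t /andP[/andP[St _] _].
  under eq_Rintegral do
    rewrite (@gapE _ _ _ _ A f (I t) t _ 0) ?linloss0 ?mxE ?subrr ?/f ?ltnNge ?St//.
  exact: Rintegral_probability_cst.
rewrite addr0 (eq_big_nat _ _ (F2 := fun s => \int[mu]_w gap A f0 (J (s %/ n)%N) s w)); last first.
  move=> t /andP[_ St]; rewrite /I minnE.
  have -> : (t %/ n - (t %/ n - S.-1) = t %/ n)%N.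
    by rewrite -minnE; apply/minn_idPl; rewrite -ltnS ltn_divLR.
  apply: eq_Rintegral => w _; apply: gap_agree => s st.
  by rewrite /f (leq_ltn_trans st St).
apply: le_trans le_f0.
(* From [ln x <= x - 1] at [x = 1 / d] and [d >= 7]. *)
have L67 : 6 / 7 <= ln d%:R :> R.
  have := @ln_le_subr1 R d%:R^-1; rewrite invr_gt0 => /(_ _).
  rewrite lnV ?posrE; last lra.
  have : d%:R^-1 <= 7^-1 :> R by rewrite lef_pV2 ?posrE; lra.
  by move=> ? /(_ ltac:(lra)); lra.
have S0 : 0 < S%:R :> R by rewrite ltr0n.
have PS : 1 + P <= 3 * S%:R by have : 0 <= (S.-1)%:R :> R by []; lra.
have nR0 : 0 < n%:R :> R by rewrite ltr0n.
have dR0 : 0 < d%:R :> R by lra.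
have := rate_bound dR0 nR0 S0 P0 (ler0n R T) TnS PS L67.
rewrite -/delta => /(ler_wpM2l (ltW G0)); lra.
Qed.
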